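(* Let $K$ be a field, let $S=K[t_1,\ldots,t_s]$ with the standard grading, let $I\subset S$ be a nonzero proper unmixed graded ideal, let $\prec$ be a monomial order on $S$, and let $d\geq 1$ be an integer. The following hold. (a) $\delta_I(d)\geq 1$. (b) ${\rm fp}_I(d)\geq 1$ if ${\rm in}_\prec(I)$ is unmixed. (c) If $\dim(S/I)\geq 1$ and $\mathcal{F}_d\neq\emptyset$ for all $d\geq 1$, then $\delta_I(d)\geq\delta_I(d+1)\geq 1$ for all $d\geq 1$.
   Context: $S=\bigoplus_{d\ge 0}S_d$ is the standard graded polynomial ring and $\mathbb{N}_+$ is the set of positive integers. For a proper graded ideal $J$ of $S$ with $k=\dim(S/J)$ (Krull dimension) and Hilbert function $H_J(d)=\dim_K(S_d/J_d)$, the degree (multiplicity) is $\deg(S/J)=(k-1)!\lim_{d\to\infty}H_J(d)/d^{k-1}$ if $k\geq 1$ and $\deg(S/J)=\dim_K(S/J)$ if $k=0$. An ideal is unmixed if all its associated primes have the same height. $(J\colon f)=\{h\in S: hf\in J\}$. For $d\geq 1$, let $\mathcal{F}_d=\{f\in S_d: f\notin I,\ (I\colon f)\neq I\}$. The minimum distance function $\delta_I\colon\mathbb{N}_+\to\mathbb{Z}$ of $I$ is $\delta_I(d)=\deg(S/I)-\max\{\deg(S/(I,f)): f\in\mathcal{F}_d\}$ if $\mathcal{F}_d\neq\emptyset$, and $\delta_I(d)=\deg(S/I)$ if $\mathcal{F}_d=\emptyset$. ${\rm in}_\prec(I)$ is the initial ideal of $I$. Let $\mathcal{M}_{\prec,d}$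 be the set of monomials $t^a\in S_d$ with $t^a\notin{\rm in}_\prec(I)$ and $({\rm in}_\prec(I)\colon t^a)\neq{\rm in}_\prec(I)$. The footprint function ${\rm fp}_I\colon\mathbb{N}_+\to\mathbb{Z}$ of $I$ (with respect to $\prec$) is ${\rm fp}_I(d)=\deg(S/I)-\max\{\deg(S/({\rm in}_\prec(I),t^a)): t^a\in\mathcal{M}_{\prec,d}\}$ if $\mathcal{M}_{\prec,d}\neq\emptyset$, and ${\rm fp}_I(d)=\deg(S/I)$ if $\mathcal{M}_{\prec,d}=\emptyset$. *)

(* Defs.v *)
From HB Require Import structures.
From mathcomp Require Import all_boot all_order all_algebra.
From mathcomp Require Import mpoly.
From mathcomp Require Import boolp classical_sets topology normedtype sequences.
Set Implicit Arguments.
Unset Strict Implicit.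
Unset Printing Implicit Defensive.
Import Order.TTheory GRing.Theory Num.Theory.
Import numFieldNormedType.Exports.
Local Open Scope classical_set_scope.
Local Open Scope ring_scope.

Section Ideals.
Variable R : comNzRingType.
Implicit Types (I J : set R) (f : R).

(* The unit ideal is allowed, unlike with MathComp's [idealr_closed]. *)
Definition is_ideal I : Prop :=
  [/\ I 0, forall f g, I f -> I g -> I (f + g) & forall f g, I g -> I (f * g)].

Definition is_prime (P : set R) : Prop :=
  [/\ is_ideal P, P <> setT & forall f g, P (f * g) -> P f \/ P g].

Definition ideal_gen (A : set R) : set R := smallest is_ideal A.

Definition ideal_adj I f : set R := ideal_gen (I `|` [set f]).

Definition colon I f : set R := [set h | I (h * f)].

(* P 0 < P 1 < ... < P n, a chain of length n; the values of P beyond n are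
   irrelevant. *)
Definition prime_chain (P : nat -> set R) (n : nat) : Prop :=
  (forall i, (i <= n)%N -> is_prime (P i)) /\
  (forall i, (i < n)%N -> P i `<` P i.+1).

(* dim (R/J): the primes of R/J are the primes of R that contain J. *)
Definition krull_dim J : nat :=
  supremum 0%N [set n | exists P, prime_chain P n /\ J `<=` P 0%N].

Definition height (P : set R) : nat :=
  supremum 0%N [set n | exists Q, prime_chain Q n /\ Q n = P].

Definition associated_prime I (P : set R) : Prop :=
  is_prime P /\ exists f, P = colon I f.

Definition unmixed I : Prop :=
  forall P Q, associated_prime I P -> associated_prime I Q ->
    height P = height Q.

End Ideals.

Section QuotientDim.
Variables (K : fieldType) (V : lmodType K).

(* The classes of v 0, ..., v (n-1) form a basis of A/(A `&` J), for subspaces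
   A and J of V. *)
Definition basis_mod (A J : set V) (n : nat) (v : 'I_n -> V) : Prop :=
  [/\ forall i, A (v i),
      forall c : 'I_n -> K, J (\sum_i c i *: v i) -> forall i, c i = 0
    & forall a, A a -> exists c : 'I_n -> K, J (a - \sum_i c i *: v i)].

(* Set to 0 when A/(A `&` J) is infinite-dimensional. *)
Definition quotient_dim (A J : set V) : nat :=
  xget 0%N [set n | exists v : 'I_n -> V, basis_mod A J v].

End QuotientDim.

Definition setmax (A : set nat) : nat :=
  xget 0%N [set m | A m /\ forall n, A n -> (n <= m)%N].

Definition monomial_order (s : nat) (mle : rel 'X_{1..s}) : Prop :=
  [/\ antisymmetric mle, transitive mle, total mle,
      forall m, mle 0%MM m
    & forall m1 m2 m, mle m1 m2 -> mle (m1 + m)%MM (m2 + m)%MM].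

Section MinimumDistance.
Variables (K : fieldType) (s : nat).
Local Notation S := {mpoly K[s]}.
Implicit Types (I J : set S) (mle : rel 'X_{1..s}) (d : nat).

Definition graded I : Prop :=
  forall f, I f -> forall d, I (pihomog mdeg d f).

Definition hilbert J d : nat :=
  quotient_dim [set f : S | f \is d.-homog] J.

(* In positive dimension the limit is taken in the rationals, and deg J is the
   natural number to which the sequence converges. *)
Definition deg J : nat :=
  if krull_dim J is k.+1 then
    xget 0%N [set e : nat |
      (fun d => (k`!)%:R * (hilbert J d)%:R / d%:R ^+ k : rat^o) @ \oo
        --> (e%:R : rat^o)]
  else quotient_dim setT J.

Definition zero_div_forms I d : set S :=
  [set f | [/\ f \is d.-homog, ~ I f & colon I f <> I]].

Definition min_dist I d : int :=
  if zero_div_forms I d == set0 then (deg I)%:Z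
  else (deg I)%:Z
       - (setmax [set deg (ideal_adj I f) | f in zero_div_forms I d])%:Z.

Definition is_lead_monom mle (f : S) (m : 'X_{1..s}) : Prop :=
  m \in msupp f /\ forall m', m' \in msupp f -> mle m' m.

Definition initial_ideal mle I : set S :=
  ideal_gen [set g | exists f m,
    [/\ I f, is_lead_monom mle f m & g = 'X_[m]]].

Definition zero_div_monoms mle I d : set 'X_{1..s} :=
  [set m | [/\ mdeg m = d, ~ initial_ideal mle I 'X_[m]
             & colon (initial_ideal mle I) 'X_[m] <> initial_ideal mle I]].

Definition footprint mle I d : int :=
  if zero_div_monoms mle I d == set0 then (deg I)%:Z
  else (deg I)%:Z
       - (setmax [set deg (ideal_adj (initial_ideal mle I) 'X_[m])
                 | m in zero_div_monoms mle I d])%:Z.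

End MinimumDistance.

(* Main.v *)
From HB Require Import structures.
Require Import Defs.
From mathcomp Require Import all_boot all_order all_algebra.
From mathcomp Require Import mpoly.
From mathcomp Require Import boolp classical_sets functions.
From mathcomp Require Import topology normedtype sequences.
From mathcomp Require Import zify ring.
Set Implicit Arguments.
Unset Strict Implicit.
Unset Printing Implicit Defensive.
Import Order.TTheory GRing.Theory Num.Theory.
Import numFieldNormedType.Exports.
Local Open Scope classical_set_scope.
Local Open Scope ring_scope.

(** Write [S] for the polynomial ring. For a form [f] of degree [e] the exact sequence
    [0 -> S/(I : f)(-e) -> S/I -> S/(I, f) -> 0] makes Hilbert functions additive
    ([cumul_adj_colon]). Let [I] be unmixed and [f] a zero divisor modulo [I] outside
    [I]. Both [(I, f)] and [I : f] lie between [I] and an associated prime of [I], and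
    all associated primes have the dimension of [I], so the three terms have the same
    dimension and [deg (I, f) = deg I - deg (I : f)] ([deg_adj_colon]). The minimum
    distance is therefore the least degree of an ideal [I : f] ([min_distP]), and the
    degree of a proper graded ideal is positive: this is (a). For (b), the same argument
    is applied to the initial ideal, which has the same Hilbert function as [I]
    by Macaulay's theorem ([cumul_initial_ideal]), hence the same degree. For (c), if
    [f] realizes the distance in degree [e] and [t_i f] is not in [I], then [I : t_i f]
    contains [I : f] and has the same dimension, so its degree is at most that of
    [I : f]; such a variable exists because otherwise [I : f] would contain all
    variables and have dimension zero.

    The work lies in the dimension theory behind this. Dimensions are read off the
    affine Hilbert function [cumul J n], the dimension of the polynomials of degree
    less than [n] modulo [J]. Noetherian induction on graded ideals ([hilbert_growth])
    shows that it eventually is a polynomial of some degree [k] with leading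
    coefficient [e / k!], where [e] is a positive integer, and yields a chain of [k + 1]
    primes above [J]. No chain is longer, because each strict inclusion of primes lowers
    the degree of growth ([cumul_prime_step]), so [k] is the Krull dimension and [e] the
    degree ([deg_growth]). Polynomial growth is expressed by iterated differences
    being eventually constant, which is stable under the operations of the induction.

    Unmixedness speaks of heights, and equal heights have to give equal dimensions:
    the height of a graded prime [P] is [s - dim (S/P)] ([height_graded_prime]). Take a
    maximal set [U] of variables algebraically independent modulo [P]. Eliminating the
    other variables one at a time, by passing to the ideal generated by the elements
    of [P] without the eliminated variables, produces a strictly descending chain of
    [s - |U|] steps from [P] ([contraction_chain]), and counting monomials gives
    [|U| <= dim (S/P)]. The converse inequality concatenates a chain below [P] with one
    above it. Finally some associated prime has the dimension of [I]: the bottom of a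
    longest chain of primes above [I] is minimal over [I], hence associated
    ([assoc_prime_below]). *)

(** * Dimensions of quotients of subspaces *)

Section QuotientDimension.
Variables (K : fieldType) (V : lmodType K).
Implicit Types (A B J : set V) (n m : nat).

Definition is_subspace J : Prop :=
  [/\ J 0, forall u v, J u -> J v -> J (u + v) & forall c v, J v -> J (c *: v)].

Lemma subspaceB J u v : is_subspace J -> J u -> J v -> J (u - v).
Proof. by case=> _ JD JZ Ju Jv; rewrite -scaleN1r; apply/JD/JZ. Qed.

Lemma subspace_sum J (T : Type) (r : seq T) (P : pred T) (F : T -> V) :
  is_subspace J -> (forall i, P i -> J (F i)) -> J (\sum_(i <- r | P i) F i).
Proof. by case=> J0 JD _ JF; apply: big_ind. Qed.

Lemma subspace_lin J n (c : 'I_n -> K) (v : 'I_n -> V) :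
  is_subspace J -> (forall i, J (v i)) -> J (\sum_i c i *: v i).
Proof. by move=> Js Jv; apply: subspace_sum => // i _; case: Js => _ _; apply. Qed.

Definition indep_mod J n (v : 'I_n -> V) : Prop :=
  forall c : 'I_n -> K, J (\sum_i c i *: v i) -> forall i, c i = 0.

Definition span_mod J n (v : 'I_n -> V) : set V :=
  [set a | exists c : 'I_n -> K, J (a - \sum_i c i *: v i)].

Lemma indep_le_span J n m (v : 'I_n -> V) (w : 'I_m -> V) : is_subspace J ->
  indep_mod J v -> (forall i, span_mod J w (v i)) -> (n <= m)%N.
Proof.
move=> Js vfree /choice[C vC].
rewrite leqNgt; apply/negP => lt_mn.
pose M : 'M[K]_(n, m) := \matrix_(i, j) C i j.
(* A nontrivial relation between the n > m rows of M is one between the v i. *)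
have kM : kermx M != 0.
  rewrite -mxrank_eq0 mxrank_ker subn_eq0 -ltnNge.
  exact: leq_ltn_trans (rank_leq_col M) lt_mn.
have /rowV0Pn[u /sub_kermxP uM u0] := kM.
case/negP: u0; apply/eqP/rowP => i; rewrite mxE.
apply: (vfree (u ord0)).
suff <- : \sum_i0 u ord0 i0 *: (v i0 - \sum_j C i0 j *: w j)
          = \sum_i0 u ord0 i0 *: v i0.
  by apply: subspace_lin.
under eq_bigr do rewrite scalerBr.
rewrite sumrB [X in _ - X](_ : _ = 0) ?subr0 //.
under eq_bigr do rewrite scaler_sumr.
rewrite exchange_big big1 //= => j _.
under eq_bigr do rewrite scalerA.
rewrite -scaler_suml.
have /rowP/(_ j) := uM; rewrite !mxE => uMj.
by rewrite (eq_bigr (fun k => u ord0 k * M k j)) ?uMj ?scale0r // => k _; rewrite mxE.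
Qed.

Definition has_dim A J n : Prop := exists v : 'I_n -> V, basis_mod A J v.

Lemma has_dim_uniq A J n m : is_subspace J -> has_dim A J n -> has_dim A J m -> n = m.
Proof.
move=> Js [v [Av vf vs]] [w [Aw wf ws]]; apply/eqP; rewrite eqn_leq.
apply/andP; split.
  by apply: (indep_le_span Js vf (w := w)) => i; apply: ws.
by apply: (indep_le_span Js wf (w := v)) => i; apply: vs.
Qed.

Lemma quotient_dimE A J n : is_subspace J -> has_dim A J n -> quotient_dim A J = n.
Proof.
move=> Js An; rewrite /quotient_dim.
by case: xgetP => [m _ Am|/(_ n)//]; apply: (has_dim_uniq Js Am An).
Qed.

Lemma has_dim_exists A J n (w : 'I_n -> V) : is_subspace J ->
  (forall a, A a -> span_mod J w a) -> exists m, has_dim A J m.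
Proof.
move=> Js Aw.
pose free_in m := exists v : 'I_m -> V, (forall i, A (v i)) /\ indep_mod J v.
have free0 : exists m, `[< free_in m >].
  by exists 0%N; apply/asboolP; exists (fun _ => 0); split=> [[]|c _ []].
have freen m : `[< free_in m >] -> (m <= n)%N.
  by move/asboolP=> [v [Av vf]]; apply: (indep_le_span Js vf (w := w)) => i; apply: Aw.
have [m] := ex_maxnP free0 freen; move=> /asboolP[v [Av vf]] mmax.
exists m; exists v; split=> // a Aa; apply: contrapT => na.
pose v' (i : 'I_m.+1) := if unlift ord0 i is Some j then v j else a.
suff : free_in m.+1 by move/asboolP/mmax; rewrite ltnn.
exists v'; split=> [i|c]; first by rewrite /v'; case: unliftP => [j|] _.
rewrite big_ord_recl /v' unlift_none.
under eq_bigr do rewrite liftK.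
move=> Jc.
have c0 : c ord0 = 0.
  apply: contrapT => /eqP c0; apply: na.
  exists (fun i => - (c ord0)^-1 * c (lift ord0 i)).
  case: Js => _ _ /(_ (c ord0)^-1 _ Jc).
  rewrite scalerDr scalerA mulVf // scale1r scaler_sumr -sumrN.
  by congr (J (_ + _)); apply: eq_bigr => i _; rewrite scalerA mulNr scaleNr opprK.
move: Jc; rewrite c0 scale0r add0r => /vf cf i.
by have [j ->|->] := unliftP ord0 i.
Qed.

Lemma indep_has_dim A J n m (v : 'I_n -> V) : is_subspace J ->
  (forall i, A (v i)) -> indep_mod J v -> has_dim A J m -> (n <= m)%N.
Proof.
by move=> Js Av vf [w [Aw _ ws]]; apply: (indep_le_span Js vf (w := w)) => i; apply: ws.
Qed.

Definition cat_fam n m (v : 'I_n -> V) (w : 'I_m -> V) (i : 'I_(n + m)) : V :=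
  match fintype.split i with inl j => v j | inr k => w k end.

Lemma sum_cat_fam n m (v : 'I_n -> V) (w : 'I_m -> V) (c : 'I_(n + m) -> K) :
  \sum_i c i *: cat_fam v w i =
  \sum_i c (lshift m i) *: v i + \sum_i c (rshift n i) *: w i.
Proof.
rewrite big_split_ord; congr (_ + _); apply: eq_bigr => i _; rewrite /cat_fam.
  by rewrite (unsplitK (inl i)).
by rewrite (unsplitK (inr i)).
Qed.

(** The additivity of dimension along the exact sequence
    [B/J2 -> A/J -> A/J1 -> 0] whose first map, induced by [phi], is injective. *)
Lemma has_dim_exact A B J J1 J2 (phi : V -> V) n m :
  linear phi -> is_subspace A -> is_subspace B -> is_subspace J -> is_subspace J1 ->
  J `<=` J1 -> (forall b, B b -> A (phi b)) -> (forall b, B b -> J1 (phi b)) ->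
  (forall b, B b -> J (phi b) <-> J2 b) ->
  (forall a, A a -> J1 a -> exists2 b, B b & J (a - phi b)) ->
  has_dim A J1 n -> has_dim B J2 m -> has_dim A J (n + m).
Proof.
move=> phil As Bs Js J1s sJ BA BJ1 BJ ex [v [Av vf vs]] [w [Bw wf ws]].
pose L : {linear V -> V} := HB.pack phi (GRing.isLinear.Build _ _ _ _ phi phil).
have phis p (c : 'I_p -> K) (u : 'I_p -> V) :
    phi (\sum_i c i *: u i) = \sum_i c i *: phi (u i).
  by rewrite -[phi]/(L : V -> V) linear_sum; apply: eq_bigr => i _; rewrite linearZ.
have phiB x y : phi (x - y) = phi x - phi y by rewrite -[phi]/(L : V -> V) linearB.
have Bsum (c : 'I_m -> K) : B (\sum_i c i *: w i) by apply: subspace_lin.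
exists (cat_fam v (phi \o w)); split.
- by move=> i; rewrite /cat_fam; case: fintype.split => j //=; apply: BA.
- move=> c; rewrite sum_cat_fam /= -phis => Jc.
  have cl : forall i, c (lshift m i) = 0.
    apply: vf; rewrite -[X in J1 X](addrK (phi (\sum_i c (rshift n i) *: w i))).
    by apply: subspaceB => //; [apply: sJ|apply: BJ1].
  have cr : forall i, c (rshift n i) = 0.
    apply: wf; apply/BJ => //; move: Jc.
    by under eq_bigr do rewrite cl scale0r; rewrite big1 // add0r.
  by move=> i; rewrite -(fintype.splitK i); case: (fintype.split i) => j /=.
- move=> a Aa; have [c Jc] := vs a Aa.
  have Ac : A (a - \sum_i c i *: v i).
    by apply: subspaceB => //; apply: subspace_lin.
  have [b Bb Jb] := ex _ Ac Jc.
  have [d Jd] := ws b Bb.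
  exists (fun i => match fintype.split i with inl j => c j | inr k => d k end).
  rewrite sum_cat_fam.
  under eq_bigr do rewrite (unsplitK (inl _)).
  under [X in _ - (_ + X)]eq_bigr do rewrite (unsplitK (inr _)) /=.
  rewrite -phis opprD addrA.
  have -> : a - \sum_i c i *: v i - phi (\sum_i d i *: w i) =
    (a - \sum_i c i *: v i - phi b) + phi (b - \sum_i d i *: w i).
    by rewrite phiB addrA subrK.
  case: Js => _ JD _; apply: JD => //; apply/BJ => //.
  by apply: subspaceB.
Qed.

End QuotientDimension.

(** * Sequences whose iterated differences are eventually constant *)

Lemma leq_expl k m n : (m <= n)%N -> (m ^ k <= n ^ k)%N.
Proof. by case: k => // k le_mn; rewrite leq_exp2r. Qed.

Definition fdiff (F : nat -> int) (n : nat) : int := F n.+1 - F n.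

(** In exact terms: [F] agrees for large arguments with a polynomial of degree
    at most [k] whose coefficient of degree [k] is [e / k!]. *)
Definition poly_growth (k : nat) (e : int) (F : nat -> int) : Prop :=
  exists n0, forall n, (n0 <= n)%N -> iter k fdiff F n = e.

Lemma iter_fdiff_shift k F a n :
  iter k fdiff (fun i => F (i + a)%N) n = iter k fdiff F (n + a)%N.
Proof. by elim: k n => //= k IHk n; rewrite /fdiff !IHk addSn. Qed.

Lemma iter_fdiffD k F G n :
  iter k fdiff (fun i => F i + G i) n = iter k fdiff F n + iter k fdiff G n.
Proof. by elim: k n => //= k IHk n; rewrite /fdiff !IHk; ring. Qed.

Lemma iter_fdiffM k c F n :
  iter k fdiff (fun i => c * F i) n = c * iter k fdiff F n.
Proof. by elim: k n => //= k IHk n; rewrite /fdiff !IHk; ring. Qed.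

Lemma poly_growth_shift a k e F :
  poly_growth k e (fun i => F (i + a)%N) <-> poly_growth k e F.
Proof.
split=> -[n0 Fe].
  exists (n0 + a)%N => n le_n; rewrite -(@subnK a n); last by lia.
  by rewrite -iter_fdiff_shift Fe //; lia.
by exists n0 => n le_n; rewrite iter_fdiff_shift Fe //; lia.
Qed.

Lemma poly_growthS k e F : poly_growth k e (fdiff F) <-> poly_growth k.+1 e F.
Proof. by split=> -[n0 Fe]; exists n0 => n /Fe; rewrite -iterSr. Qed.

Lemma poly_growthD k e1 e2 F G : poly_growth k e1 F -> poly_growth k e2 G ->
  poly_growth k (e1 + e2) (fun n => F n + G n).
Proof.
move=> [n1 F1] [n2 G2]; exists (n1 + n2)%N => n le_n.
by rewrite iter_fdiffD F1 ?G2 //; lia.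
Qed.

Lemma poly_growthM k c e F : poly_growth k e F ->
  poly_growth k (c * e) (fun n => c * F n).
Proof. by move=> [n0 Fe]; exists n0 => n /Fe <-; rewrite iter_fdiffM. Qed.

Lemma poly_growth_lt k1 k2 e F : (k1 < k2)%N -> poly_growth k1 e F ->
  poly_growth k2 0 F.
Proof.
move=> lt_k [n0 Fe]; exists n0 => n le_n.
rewrite -(subnK lt_k) iterD; set p := (k2 - k1.+1)%N.
elim: p n le_n => [|p IHp] n le_n /=; first by rewrite /fdiff !Fe ?subrr //; lia.
by rewrite /fdiff !IHp ?subrr //; lia.
Qed.

Lemma poly_growth_binom k : poly_growth k 1 (fun n => 'C(n, k)%:Z).
Proof.
elim: k => [|k IHk]; first by exists 0%N => n _; rewrite /= bin0.
apply/poly_growthS; case: IHk => n0 Hk; exists n0 => n /Hk <-.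
congr (iter k fdiff _ n); apply/funext => i.
by rewrite /fdiff binS PoszD; ring.
Qed.

Lemma poly_growth_bound k e F : poly_growth k e F ->
  exists C : nat, forall n, `|F n| <= (C * n.+1 ^ k)%:Z.
Proof.
elim: k e F => [|k IHk] e F.
  move=> [n0 Fe]; exists (`|e| + \sum_(i < n0) `|F i|)%N => n.
  rewrite expn0 muln1; have [/Fe /= ->|lt_n] := leqP n0 n; first lia.
  by rewrite (bigD1 (Ordinal lt_n)) //=; lia.
move=> /poly_growthS/IHk[C FC]; exists (`|F 0%N| + C)%N.
elim=> [|n IHn]; first by rewrite exp1n; lia.
have -> : F n.+1 = F n + fdiff F n by rewrite /fdiff; ring.
apply: le_trans (ler_normD _ _) _; apply: le_trans (lerD IHn (FC n)) _.
rewrite -PoszD lez_nat expnS [(n.+2 ^ k.+1)%N]expnS.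
have : (n.+1 ^ k <= n.+2 ^ k)%N by by apply: leq_expl.
nia.
Qed.

(** Descending induction: a sequence of negative slope is eventually negative. *)
Lemma poly_growth_ge0 k e F : (forall n, 0 <= F n) -> poly_growth k e F -> 0 <= e.
Proof.
move=> F0 [n0 Fe]; rewrite leNgt; apply/negP => e_lt0.
suff: exists n1, forall n, (n1 <= n)%N -> iter 0 fdiff F n <= -1.
  by move=> [n1 /(_ n1 (leqnn _))] /=; have := F0 n1; lia.
have: exists n1, forall n, (n1 <= n)%N -> iter k fdiff F n <= -1.
  by exists n0 => n /Fe ->; lia.
elim: k {Fe} => [//|k IHk] [n1 Hn1]; apply: IHk.
have dec i : iter k fdiff F (n1 + i)%N <= iter k fdiff F n1 - i%:Z.
  elim: i => [|i IHi]; first by rewrite addn0 subr0.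
  have := Hn1 (n1 + i)%N (leq_addr _ _); rewrite /= {1}/fdiff addnS; lia.
exists (n1 + `|iter k fdiff F n1|.+1)%N => n le_n.
by have := dec (n - n1)%N; rewrite subnKC; lia.
Qed.

Lemma poly_growth_le k e1 e2 F G : (forall n, F n <= G n) ->
  poly_growth k e1 F -> poly_growth k e2 G -> e1 <= e2.
Proof.
move=> FG Fe Ge; rewrite -subr_ge0.
apply: (@poly_growth_ge0 k _ (fun n => G n + (-1) * F n)).
  by move=> n; have := FG n; lia.
by rewrite -[- e1]mulN1r; apply: poly_growthD => //; apply: poly_growthM.
Qed.

Lemma poly_growth_uniq k e1 e2 F :
  poly_growth k e1 F -> poly_growth k e2 F -> e1 = e2.
Proof.
by move=> [n1 F1] [n2 F2]; rewrite -(F1 (n1 + n2)%N) ?(F2 (n1 + n2)%N) //; lia.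
Qed.

Lemma poly_growth_deg_uniq k1 k2 e1 e2 F : 1 <= e1 -> 1 <= e2 ->
  poly_growth k1 e1 F -> poly_growth k2 e2 F -> k1 = k2.
Proof.
move=> e1_gt0 e2_gt0 F1 F2; case: (ltngtP k1 k2) => // lt_k.
  by have := poly_growth_uniq F2 (poly_growth_lt lt_k F1); lia.
by have := poly_growth_uniq F1 (poly_growth_lt lt_k F2); lia.
Qed.

Lemma exp_growth_le n k C : (forall m, m.+1 ^ n <= C * m.+1 ^ k)%N -> (n <= k)%N.
Proof.
move=> Hm; rewrite leqNgt; apply/negP => lt_kn.
have := Hm C; rewrite -(subnK (ltnW lt_kn)) expnD leq_pmul2r ?expn_gt0 //.
by rewrite leqNgt -{1}[C.+1]expn1 (leq_trans (ltnSn C)) //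
  -{1}[C.+1]expn1 leq_pexp2l // subn_gt0.
Qed.

Lemma exp_le_binom m n : (m.+1 ^ n <= n`! * 'C(m + n, n))%N.
Proof.
rewrite mulnC bin_ffact; elim: n => [|n IHn]; first by rewrite ffactn0.
by rewrite addnS ffactSS expnS leq_mul // ltnS leq_addr.
Qed.

Lemma cvg_ffact k :
  (fun n => (n ^_ k)%:R / n%:R ^+ k : rat^o) @ \oo --> (1 : rat^o).
Proof.
elim: k => [|k IHk].
  rewrite (_ : (fun n => _) = fun=> 1); first exact: cvg_cst.
  by apply/funext => n; rewrite ffactn0 expr0 divr1.
have inv0 : (fun n => (n%:R : rat^o)^-1) @ \oo --> (0 : rat^o).
  rewrite -cvg_shiftS; exact: cvg_harmonic.
rewrite -[X in _ --> X]mulr1.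
have lin1 : (fun n => 1 - k%:R * (n%:R : rat^o)^-1) @ \oo --> (1 : rat^o).
  rewrite -[X in _ --> X]subr0; apply: cvgB; first exact: cvg_cst.
  rewrite -[X in _ --> X](mulr0 k%:R).
  by apply: cvgM => //; exact: cvg_cst.
apply: cvg_trans (cvgM IHk lin1).
apply: near_eq_cvg; near=> n.
have n_gt : (k < n)%N by near: n; exact: nbhs_infty_gt.
have n0 : n%:R != 0 :> rat by rewrite pnatr_eq0; lia.
rewrite /= ffactnSr natrM natrB; last by lia.
by rewrite exprSr; field; rewrite n0 expf_neq0.
Unshelve. all: by end_near.
Qed.

(** [F n - e C(n, k)] has growth of degree less than [k], so it is [O(n^(k-1))],
    whereas [k! C(n, k)] is the falling factorial, asymptotic to [n^k]. *)
Lemma poly_growth_cvg k e F : poly_growth k e F ->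
  (fun n => (k`!)%:R * (F n)%:~R / n%:R ^+ k : rat^o) @ \oo --> (e%:~R : rat^o).
Proof.
move=> Fe.
pose G n := F n + (- e) * 'C(n, k)%:Z.
have G0 : poly_growth k 0 G.
  rewrite -(subrr e) -[X in e + X]mulr1.
  by apply: poly_growthD => //; apply: poly_growthM (poly_growth_binom k).
have inv0 : (fun n => (n%:R : rat^o)^-1) @ \oo --> (0 : rat^o).
  rewrite -cvg_shiftS; exact: cvg_harmonic.
have Gcvg : (fun n => (G n)%:~R / n%:R ^+ k : rat^o) @ \oo --> (0 : rat^o).
  case: k @G Fe G0 => [|k] G Fe G0.
    have [n0 Gn0] := G0; apply: cvg_near_cst; near=> n.
    have le_n : (n0 <= n)%N by near: n; exact: nbhs_infty_ge.
    by have /= -> := Gn0 n le_n; rewrite mul0r.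
  have [n0 Gn0] := G0.
  have /poly_growth_bound[C GC] : poly_growth k (iter k fdiff G n0) G.
    exists n0 => n le_n; rewrite -(subnKC le_n).
    elim: (n - n0)%N => [|i IHi]; first by rewrite addn0.
    rewrite addnS -IHi; have := Gn0 (n0 + i)%N (leq_addr _ _).
    by rewrite /= {1}/fdiff; move/eqP; rewrite subr_eq0 => /eqP.
  apply/cvgr0Pnorm_le => eps eps_gt0.
  have CK : (fun n => (C * 2 ^ k)%:R * (n%:R : rat^o)^-1) @ \oo --> (0 : rat^o).
    rewrite -[X in _ --> X](mulr0 (C * 2 ^ k)%:R).
    by apply: cvgM => //; exact: cvg_cst.
  have /cvgr0Pnorm_le/(_ eps eps_gt0) CKe := CK.
  near=> n.
  have n_gt : (0 < n)%N by near: n; exact: nbhs_infty_gt.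
  have n0' : 0 < n%:R :> rat by rewrite ltr0n.
  have : `|(C * 2 ^ k)%:R * (n%:R : rat)^-1| <= eps by near: n.
  apply: le_trans; rewrite [leRHS]ger0_norm; last first.
    by rewrite mulr_ge0 ?invr_ge0 ?ler0n.
  rewrite normrM normfV [`|n%:R ^+ _|]ger0_norm ?exprn_ge0 ?ler0n //.
  rewrite ler_pdivrMr ?exprn_gt0 // exprS mulrA divfK ?gt_eqF //.
  rewrite -natrX -natrM -intr_norm.
  have := GC n; rewrite -(ler_int rat) => /le_trans; apply.
  rewrite -pmulrn ler_nat -mulnA leq_mul2l; apply/orP; right.
  by rewrite -expnMn; apply: leq_expl; lia.
rewrite -[X in _ --> X]addr0 -[X in _ --> X + _]mulr1.
rewrite -[X in _ --> _ + X](mulr0 (k`!)%:R).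
have h1 : (fun n => e%:~R * ((n ^_ k)%:R / n%:R ^+ k) : rat^o) @ \oo -->
  (e%:~R * 1 : rat^o) by apply: cvgM (cvg_ffact k); exact: cvg_cst.
have h2 : (fun n => (k`!)%:R * ((G n)%:~R / n%:R ^+ k) : rat^o) @ \oo -->
  ((k`!)%:R * 0 : rat^o) by apply: cvgM Gcvg; exact: cvg_cst.
apply: cvg_trans (cvgD h1 h2).
apply: near_eq_cvg; near=> n.
have n_gt : (0 < n)%N by near: n; exact: nbhs_infty_gt.
have n0' : n%:R != 0 :> rat by rewrite pnatr_eq0; lia.
rewrite fctE /= /G intrD intrM mulrNz -bin_ffact natrM.
by rewrite -pmulrn; field; rewrite expf_neq0.
Unshelve. all: by end_near.
Qed.

(** * Ideals and primes *)

Section IdealTheory.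
Variable R : comNzRingType.
Implicit Types (I J P Q : set R) (f g : R).

Lemma ideal0 I : is_ideal I -> I 0.
Proof. by case. Qed.

Lemma idealD I f g : is_ideal I -> I f -> I g -> I (f + g).
Proof. by case=> _ ID _; apply: ID. Qed.

Lemma ideal_mull I f g : is_ideal I -> I g -> I (f * g).
Proof. by case=> _ _ IM; apply: IM. Qed.

Lemma ideal_mulr I f g : is_ideal I -> I f -> I (f * g).
Proof. by rewrite mulrC; apply: ideal_mull. Qed.

Lemma idealN I f : is_ideal I -> I f -> I (- f).
Proof. by move=> Ii If; rewrite -mulN1r; apply: ideal_mull. Qed.

Lemma idealB I f g : is_ideal I -> I f -> I g -> I (f - g).
Proof. by move=> Ii If Ig; apply: idealD => //; apply: idealN. Qed.

Lemma ideal_sum I (T : eqType) (r : seq T) (P : pred T) (F : T -> R) :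
  is_ideal I -> (forall i, i \in r -> P i -> I (F i)) -> I (\sum_(i <- r | P i) F i).
Proof.
move=> Ii IF; rewrite big_seq_cond; apply: big_ind.
- exact: ideal0.
- by move=> x y; apply: idealD.
- by move=> i /andP[]; apply: IF.
Qed.

Lemma ideal_addKr I f g : is_ideal I -> I g -> I (f + g) -> I f.
Proof. by move=> Ii Ig Ifg; rewrite -(addrK g f); apply: idealB. Qed.

Lemma ideal_proper I : is_ideal I -> I <> setT <-> ~ I 1.
Proof.
move=> Ii; split=> [IT I1|I1 IT]; last by apply: I1; rewrite IT.
by apply: IT; rewrite -subTset => f _; rewrite -[f]mulr1; apply: ideal_mull.
Qed.

Lemma prime_ideal P : is_prime P -> is_ideal P.
Proof. by case. Qed.

Lemma prime_proper P : is_prime P -> ~ P 1.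
Proof. by case=> Pi PT _; apply/ideal_proper. Qed.

Lemma primeM P f g : is_prime P -> P (f * g) -> P f \/ P g.
Proof. by case=> _ _ PM; apply: PM. Qed.

Lemma ideal_gen_ideal (A : set R) : is_ideal (ideal_gen A).
Proof.
split.
- by move=> I [[]].
- by move=> f g Af Ag I IA; case: (IA) => Ii _; apply: idealD (Af _ IA) (Ag _ IA).
- by move=> f g Ag I IA; case: (IA) => Ii _; apply: ideal_mull (Ag _ IA).
Qed.

Lemma ideal_adjE I f : is_ideal I ->
  ideal_adj I f = [set h | exists2 i, I i & exists g, h = i + g * f].
Proof.
move=> Ii; apply/seteqP; split.
  apply: smallest_sub; first split.
  - by exists 0; [exact: ideal0|exists 0; rewrite mul0r addr0].
  - move=> _ _ [i Ii' [g ->]] [j Ij [h ->]].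
    by exists (i + j); [apply: idealD|exists (g + h); ring].
  - move=> h _ [i Ii' [g ->]].
    by exists (h * i); [apply: ideal_mull|exists (h * g); ring].
  - move=> h [Ih|->]; first by exists h => //; exists 0; rewrite mul0r addr0.
    by exists 0; [exact: ideal0|exists 1; rewrite mul1r add0r].
move=> _ [i Ii' [g ->]].
have adjI := ideal_gen_ideal (I `|` [set f]).
apply: (idealD adjI); first by apply: sub_gen_smallest; left.
by apply: (ideal_mull _ adjI); apply: sub_gen_smallest; right.
Qed.

Lemma ideal_adj_ideal I f : is_ideal (ideal_adj I f).
Proof. exact: ideal_gen_ideal. Qed.

Lemma sub_ideal_adj I f : I `<=` ideal_adj I f.
Proof. by move=> g Ig; apply: sub_gen_smallest; left. Qed.

Lemma ideal_adj_mem I f : ideal_adj I f f.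
Proof. by apply: sub_gen_smallest; right. Qed.

Lemma ideal_adj_sub I J f : is_ideal J -> I `<=` J -> J f -> ideal_adj I f `<=` J.
Proof. by move=> Ji IJ Jf; apply: smallest_sub => // g [/IJ|->]. Qed.

Lemma colon_ideal I f : is_ideal I -> is_ideal (colon I f).
Proof.
move=> Ii; split; rewrite /colon /=.
- by rewrite mul0r; apply: ideal0.
- by move=> g h; rewrite mulrDl; apply: idealD.
- by move=> g h; rewrite -mulrA; apply: ideal_mull.
Qed.

Lemma sub_colon I f : is_ideal I -> I `<=` colon I f.
Proof. by move=> Ii g; apply: ideal_mulr. Qed.

Lemma colon_colon I f g : colon (colon I f) g = colon I (g * f).
Proof. by apply/seteqP; split=> h; rewrite /colon /= mulrA. Qed.

Lemma colon_prime P f : is_prime P -> ~ P f -> colon P f = P.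
Proof.
move=> Pp Pf; apply/seteqP; split=> g; last exact: sub_colon (prime_ideal Pp) g.
by case/(primeM Pp).
Qed.

(** Gauss's argument: the product of the last coefficients of [p] and [q]
    outside [J] is, modulo [J], a coefficient of [p * q]. *)
Lemma poly_mul_coef_ideal J (p q : {poly R}) : is_ideal J ->
  (forall i j, J (p`_i * q`_j) -> J p`_i \/ J q`_j) ->
  (forall n, J (p * q)`_n) -> (forall i, J p`_i) \/ (forall j, J q`_j).
Proof.
move=> Ji Jpq Jmul.
have last_coef (r : {poly R}) : ~ (forall i, J r`_i) ->
    exists2 a, ~ J r`_a & forall i, (a < i)%N -> J r`_i.
  move=> /existsNP[i0 ri0].
  have ex0 : exists i, `[< ~ J r`_i >] by exists i0; apply/asboolP.
  have bnd i : `[< ~ J r`_i >] -> (i <= size r)%N.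
    move/asboolP => ri; rewrite leqNgt; apply/negP => lt_i.
    by apply: ri; rewrite nth_default ?(ltnW lt_i) //; apply: ideal0.
  have [a /asboolP ra amax] := ex_maxnP ex0 bnd; exists a => // i lt_ai.
  apply: contrapT => ri.
  have : (i <= a)%N by apply: amax; apply/asboolP.
  by rewrite leqNgt lt_ai.
apply: contrapT => /not_orP[/last_coef[a pa pmax] /last_coef[b qb qmax]].
have := Jmul (a + b)%N; rewrite coefM.
have a_lt : (a < (a + b).+1)%N by rewrite ltnS leq_addr.
rewrite (bigD1 (Ordinal a_lt)) //= addKn => Jsum.
have /Jpq[] // : J (p`_a * q`_b).
apply: ideal_addKr Jsum => //; apply: ideal_sum => // i _ neq_ia.
have [lt_ia|lt_ai|eq_ia] := ltngtP i a.
- by apply: ideal_mull => //; apply: qmax; have := ltn_ord i; lia.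
- by apply: ideal_mulr => //; apply: pmax.
- by case/eqP: neq_ia; apply/val_inj.
Qed.

Lemma poly_prime P : is_prime P -> is_prime [set p : {poly R} | forall i, P p`_i].
Proof.
move=> Pp; have Pi := prime_ideal Pp; split; first split.
- by move=> i; rewrite coef0; apply: ideal0.
- by move=> p q /= Hp Hq i; rewrite coefD; apply: idealD.
- by move=> p q /= Hq i; rewrite coefM; apply: ideal_sum => // j _ _; apply: ideal_mull.
- move=> PT; apply: (prime_proper Pp).
  by have : [set p : {poly R} | forall i, P p`_i] 1 by [rewrite PT]; move=> /(_ 0%N);
    rewrite coef1.
- by move=> p q /=; apply: poly_mul_coef_ideal => // i j; apply: primeM.
Qed.

End IdealTheory.

Lemma preimage_prime (R R' : comNzRingType) (phi : {rmorphism R -> R'}) P :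
  is_prime P -> is_prime (phi @^-1` P).
Proof.
move=> Pp; have Pi := prime_ideal Pp; split; first split.
- by rewrite /preimage /= rmorph0; apply: ideal0.
- by move=> f g; rewrite /preimage /= rmorphD; apply: idealD.
- by move=> f g; rewrite /preimage /= rmorphM; apply: ideal_mull.
- move=> PT; apply: (prime_proper Pp); rewrite -(rmorph1 phi).
  by have : (phi @^-1` P) 1 by rewrite PT.
- by move=> f g; rewrite /preimage /= rmorphM; apply: primeM.
Qed.

(** * Components of prescribed degrees *)

Section Graded.
Variables (K : fieldType) (s : nat).
Local Notation S := {mpoly K[s]}.
Implicit Types (f g : S) (I J P Q : set S) (D : pred nat) (m : 'X_{1..s}).

Lemma ideal_subspace J : is_ideal J -> is_subspace J.
Proof.
move=> Ji; split; first exact: ideal0.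
  by move=> f g; apply: idealD.
by move=> c f; rewrite -mul_mpolyC; apply: ideal_mull.
Qed.

Definition in_deg D : set S := [set f | forall m, m \in msupp f -> D (mdeg m)].

Definition deg_part D f : S := \sum_(m <- msupp f | D (mdeg m)) f@_m *: 'X_[m].

Lemma mcoeff_deg_part D f m : (deg_part D f)@_m = if D (mdeg m) then f@_m else 0.
Proof.
rewrite /deg_part [LHS]raddf_sum /=.
under eq_bigr do rewrite mcoeffZ mcoeffX.
have [fm|/memN_msupp_eq0 fm] := boolP (m \in msupp f); last first.
  rewrite fm if_same big1_seq // => m' /andP[_ fm'].
  case: eqP => [eq_m|_]; last by rewrite mulr0.
  by move: fm'; rewrite eq_m mcoeff_msupp fm eqxx.
rewrite big_mkcond (bigD1_seq m) ?msupp_uniq //= eqxx mulr1.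
rewrite big1 ?addr0 // => m' /negPf ->; rewrite mulr0; exact: if_same.
Qed.

Lemma in_degP D f : in_deg D f <-> forall m, ~~ D (mdeg m) -> f@_m = 0.
Proof.
split=> [fD m /negP mD|fD m].
  by apply: memN_msupp_eq0; apply/negP => /fD.
by rewrite mcoeff_msupp; apply: contraNT => /fD ->.
Qed.

Lemma deg_part_id D f : in_deg D f -> deg_part D f = f.
Proof.
move=> /in_degP fD; apply/mpolyP => m; rewrite mcoeff_deg_part.
by case: ifPn => // /fD.
Qed.

Lemma in_deg_part D f : in_deg D (deg_part D f).
Proof. by apply/in_degP => m /negPf Dm; rewrite mcoeff_deg_part Dm. Qed.

Lemma deg_part_is_linear D : linear (deg_part D).
Proof.
move=> c f g; apply/mpolyP => m; rewrite mcoeffD mcoeffZ !mcoeff_deg_part.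
by case: ifP => _; rewrite ?mcoeffD ?mcoeffZ // mulr0 addr0.
Qed.

HB.instance Definition _ D :=
  GRing.isLinear.Build K S S _ (deg_part D) (deg_part_is_linear D).

Lemma in_deg_subspace D : is_subspace (in_deg D).
Proof.
split=> [m|f g /in_degP fD /in_degP gD|c f /in_degP fD]; first by rewrite msupp0.
  by apply/in_degP => m mD; rewrite mcoeffD fD ?gD ?addr0.
by apply/in_degP => m mD; rewrite mcoeffZ fD ?mulr0.
Qed.

Lemma in_deg1 d : in_deg (pred1 d) = [set f | f \is d.-homog].
Proof.
apply/seteqP; split=> f /= fd; first by apply/dhomogP => m /fd /eqP.
by move=> m; apply: contraTT => /(dhomog_nemf_coeff fd) fm; rewrite mcoeff_msupp fm eqxx.
Qed.

Lemma deg_part1 d f : deg_part (pred1 d) f = pihomog mdeg d f.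
Proof. by rewrite /deg_part /pihomog. Qed.

Lemma deg_part_pihomog D f :
  deg_part D f = \sum_(d < msize f | D d) pihomog mdeg d f.
Proof.
apply/mpolyP => m; rewrite mcoeff_deg_part [RHS]raddf_sum /=.
under eq_bigr do rewrite -deg_part1 mcoeff_deg_part /= eq_sym.
have [lt_m|/msize_mdeg_ge/memN_msupp_eq0 ->] := ltnP (mdeg m) (msize f); last first.
  by rewrite if_same big1 // => i _; rewrite if_same.
case: ifPn => Dm.
  rewrite (bigD1 (Ordinal lt_m)) //= eqxx big1 ?addr0 // => i /andP[_ /negPf].
  by rewrite -val_eqE /= => ->.
by rewrite big1 // => i Di; case: eqP => // eq_i; move: Dm; rewrite -eq_i Di.
Qed.

Lemma graded_deg_part J D f : is_ideal J -> graded J -> J f -> J (deg_part D f).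
Proof.
by move=> Ji Jg Jf; rewrite deg_part_pihomog; apply: ideal_sum => // i _ _; apply: Jg.
Qed.

Lemma deg_partM D e g f : f \is e.-homog ->
  deg_part D (g * f) = deg_part (fun d => D (d + e)%N) g * f.
Proof.
move=> fe; rewrite [g in LHS]mpolyE mulr_suml [f in LHS]mpolyE.
under eq_bigr do rewrite mulr_sumr.
rewrite linear_sum /=.
rewrite [in RHS]/deg_part mulr_suml [RHS]big_mkcond /=; apply: eq_bigr => m _.
rewrite linear_sum /=.
rewrite [f in RHS]mpolyE.
rewrite (_ : (if _ then _ else _) = \sum_(m' <- msupp f)
   if D (mdeg m + e)%N then (g@_m *: 'X_[m]) * (f@_m' *: 'X_[m']) else 0); last first.
  by case: ifP => _; [rewrite mulr_sumr|rewrite big1].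
apply: eq_big_seq => m' /(dhomog_mf fe) m'e.
rewrite -scalerAl -scalerAr -mpolyXD; apply/mpolyP => k.
rewrite mcoeff_deg_part [RHS](fun_if (mcoeff k)) mcoeff0 !mcoeffZ mcoeffX.
case: eqVneq => [<-|_]; last by rewrite !mulr0 !if_same.
by rewrite mdegD m'e.
Qed.

Lemma in_degM D e g f : f \is e.-homog -> in_deg (fun d => D (d + e)%N) g ->
  in_deg D (g * f).
Proof. by move=> fe /deg_part_id <-; rewrite -deg_partM //; apply: in_deg_part. Qed.

Lemma pihomogM d e g f : f \is e.-homog ->
  pihomog mdeg (d + e) (g * f) = pihomog mdeg d g * f.
Proof.
move=> fe; rewrite -!deg_part1 (deg_partM _ _ fe); congr (_ * f).
by apply/mpolyP => m; rewrite !mcoeff_deg_part /= eqn_add2r.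
Qed.

Lemma gradedP J : is_ideal J ->
  (forall f D, J f -> J (deg_part D f)) -> graded J.
Proof. by move=> Ji JD f Jf d; rewrite -deg_part1; apply: JD. Qed.

Lemma graded_adj J f e : is_ideal J -> graded J -> f \is e.-homog ->
  graded (ideal_adj J f).
Proof.
move=> Ji Jg fe; apply: gradedP; first exact: ideal_adj_ideal.
move=> h D; rewrite ideal_adjE // => -[i Ji' [g ->]].
exists (deg_part D i); first exact: graded_deg_part.
by exists (deg_part (fun d => D (d + e)%N) g); rewrite linearD /= (deg_partM _ _ fe).
Qed.

Lemma graded_colon J f e : is_ideal J -> graded J -> f \is e.-homog ->
  graded (colon J f).
Proof.
move=> Ji Jg fe h; rewrite /colon /= => Jhf d.
by rewrite -(pihomogM _ _ fe); apply: Jg.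
Qed.

Lemma graded_homog_notin J f : is_ideal J -> ~ J f ->
  exists2 d, ~ J (pihomog mdeg d f) & pihomog mdeg d f \is d.-homog.
Proof.
move=> Ji Jf; apply: contrapT => nd; apply: Jf.
rewrite (pihomog_partitionE (leqnn (mmeasure mdeg f))).
apply: ideal_sum => // i _ _; apply: contrapT => nJ; apply: nd.
by exists i => //; apply: pihomogP.
Qed.

Definition homog_prime J : Prop :=
  forall d e f g, f \is d.-homog -> g \is e.-homog -> J (f * g) -> J f \/ J g.

(** The substitution [t_i |-> t_i X] turns the homogeneous components of a polynomial
    into the coefficients of the powers of [X]. *)
Definition homogenization : S -> {poly S} :=
  mmap (polyC \o @mpolyC s K) (fun i => ('X_i)%:P * 'X).

HB.instance Definition _ := GRing.RMorphism.on homogenization.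

Lemma homogenizationX m : homogenization 'X_[m] = ('X_[m])%:P * 'X^(mdeg m).
Proof.
rewrite /homogenization mmapX /mmap1.
under eq_bigr do rewrite exprMn -rmorphXn.
rewrite big_split /= -rmorph_prod -mpolyXE_id; congr (_ * _).
by rewrite prodrXr mdegE.
Qed.

Lemma coef_homogenization f d : (homogenization f)`_d = pihomog mdeg d f.
Proof.
rewrite [f in LHS]mpolyE rmorph_sum /= coef_sum -deg_part1 /deg_part.
rewrite [RHS]big_mkcond /=; apply: eq_bigr => m _.
rewrite -mul_mpolyC rmorphM /= homogenizationX [homogenization _%:MP]mmapC /=.
rewrite !coefCM coefXn eq_sym; case: eqP => _; last by rewrite !mulr0.
by rewrite mulr1.
Qed.

Lemma homogenization_exists : exists phi : {rmorphism S -> {poly S}},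
  forall f d, (phi f)`_d = pihomog mdeg d f.
Proof. by exists homogenization => f d; apply: coef_homogenization. Qed.

(** A graded ideal can be tested for primality on forms, by applying Gauss's argument
    to the images of polynomials under [homogenization]. *)
Lemma homog_prime_prime J : is_ideal J -> graded J -> ~ J 1 -> homog_prime J ->
  is_prime J.
Proof.
move=> Ji Jg J1 Jp; split=> //; first exact/ideal_proper.
move=> f g Jfg; have [phi phiE] := homogenization_exists.
have comp h : (forall i, J (phi h)`_i) -> J h.
  move=> Jh; apply: contrapT => /(graded_homog_notin Ji)[d].
  by rewrite -phiE.
case: (@poly_mul_coef_ideal _ J (phi f) (phi g)) => //.
- move=> i j; rewrite (phiE f i) (phiE g j).
  exact: Jp _ _ _ _ (pihomogP mdeg i f) (pihomogP mdeg j g).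
- by move=> n; rewrite -rmorphM (phiE (f * g) n); apply: Jg.
- by move/comp; left.
- by move/comp; right.
Qed.

(** * Hilbert functions *)

(** The affine Hilbert function, cumulative in the degree. It makes sense for every
    ideal, which matters because the primes of a chain need not be graded. *)
Definition cumul J n : nat := quotient_dim (in_deg (fun d => (d < n)%N)) J.

Lemma in_deg_spanned D N J : (forall d, D d -> (d < N)%N) -> is_ideal J ->
  exists w : 'I_#|[set: 'X_{1..s < N}]%SET| -> S,
    forall f, in_deg D f -> span_mod J w f.
Proof.
move=> DN Ji.
pose mon (i : 'I_#|[set: 'X_{1..s < N}]%SET|) : 'X_{1..s} :=
  (enum_val i : 'X_{1..s < N}).
exists (fun i => 'X_[mon i]) => f Df; exists (fun i => f@_(mon i)).
have fN : (msize f <= N)%N.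
  by rewrite msizeE; apply/bigmax_leqP_seq => m fm _; apply/DN/Df.
rewrite [X in f - X](_ : _ = f) ?subrr; first exact: ideal0.
rewrite [RHS](mpolywE fN).
rewrite (eq_bigl (fun m : 'X_{1..s < N} => m \in [set: 'X_{1..s < N}]%SET)).
  by rewrite [RHS]big_enum_val; apply: eq_bigr.
by move=> m; rewrite inE.
Qed.

Lemma has_dim_finite D N J : (forall d, D d -> (d < N)%N) -> is_ideal J ->
  has_dim (in_deg D) J (quotient_dim (in_deg D) J).
Proof.
move=> DN Ji; have Js := ideal_subspace Ji.
have [w wP] := in_deg_spanned DN Ji.
by have [n Dn] := has_dim_exists Js wP; rewrite (quotient_dimE Js Dn).
Qed.

Lemma has_dim_cumul J n : is_ideal J ->
  has_dim (in_deg (fun d => d < n)%N) J (cumul J n).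
Proof. by apply: has_dim_finite => d; apply. Qed.

Lemma has_dim_hilbert J d : is_ideal J ->
  has_dim (in_deg (pred1 d)) J (hilbert J d).
Proof.
move=> Ji; rewrite /hilbert -in_deg1.
by apply: has_dim_finite Ji => e /eqP ->; apply: ltnSn.
Qed.

(** The exact sequence [0 -> S/(J : f)(-e) -> S/J -> S/(J, f) -> 0]. *)
Lemma has_dim_adj_colon D J f e n k : is_ideal J -> graded J -> f \is e.-homog ->
  has_dim (in_deg D) (ideal_adj J f) n ->
  has_dim (in_deg (fun d => D (d + e)%N)) (colon J f) k ->
  has_dim (in_deg D) J (n + k).
Proof.
move=> Ji Jg fe; pose phi (b : S) : S := b * f.
apply: (has_dim_exact (phi := phi)).
- by move=> c x y; rewrite /phi mulrDl scalerAl.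
- exact: in_deg_subspace.
- exact: in_deg_subspace.
- exact: ideal_subspace.
- exact/ideal_subspace/ideal_adj_ideal.
- exact: sub_ideal_adj.
- by move=> b; apply: (in_degM fe).
- by move=> b _; apply: (ideal_mull b (ideal_adj_ideal J f)); apply: ideal_adj_mem.
- by [].
- move=> a /deg_part_id aD; rewrite ideal_adjE // => -[i Ji' [g ag]].
  exists (deg_part (fun d => D (d + e)%N) g); first exact: in_deg_part.
  rewrite -aD ag linearD /= (deg_partM _ _ fe) addrK.
  exact: graded_deg_part.
Qed.

Lemma has_dim_disjoint D1 D2 J n k : is_ideal J -> graded J ->
  (forall d, D1 d -> ~~ D2 d) ->
  has_dim (in_deg D1) J n -> has_dim (in_deg D2) J k ->
  has_dim (in_deg (fun d => D1 d || D2 d)) J (n + k).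
Proof.
move=> Ji Jg D12 [v [vD vf vs]] D2k; have Js := ideal_subspace Ji.
have partv (c : 'I_n -> K) :
    deg_part D1 (\sum_i c i *: v i) = \sum_i c i *: v i.
  exact: deg_part_id (subspace_lin c (in_deg_subspace D1) vD).
apply: (@has_dim_exact _ _ _ (in_deg D2) J [set a | J (deg_part D1 a)] J id) => //.
- exact: in_deg_subspace.
- exact: in_deg_subspace.
- split=> /= [|a b|c a]; first by rewrite linear0; apply: ideal0.
    by rewrite linearD /=; apply: idealD.
  by rewrite linearZ /=; case: Js => _ _; apply.
- by move=> a Ja /=; apply: graded_deg_part.
- by move=> b D2b m /D2b ->; rewrite orbT.
- move=> b /in_degP D2b; rewrite /= (_ : deg_part D1 b = 0); first exact: ideal0.
  apply/mpolyP => m; rewrite mcoeff_deg_part mcoeff0.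
  by case: ifP => // /D12 /D2b.
- move=> a aD Ja; exists (deg_part D2 a); first exact: in_deg_part.
  rewrite (_ : a - _ = deg_part D1 a) //; apply/mpolyP => m.
  move/in_degP: aD => /(_ m); rewrite mcoeffB !mcoeff_deg_part.
  have := D12 (mdeg m); case: (D1 _); case: (D2 _) => //=; rewrite ?subr0 ?subrr //.
    by move=> /(_ isT).
  by move=> _ ->.
exists v; split=> [i m /vD ->//|c|a aD] /=; first by rewrite partv; apply: vf.
have [c Jc] := vs _ (@in_deg_part D1 a).
by exists c; rewrite linearB /= partv.
Qed.

Lemma cumulS J n : is_ideal J -> graded J ->
  cumul J n.+1 = (cumul J n + hilbert J n)%N.
Proof.
move=> Ji Jg; apply: quotient_dimE; first exact: ideal_subspace.
rewrite (_ : in_deg _ = in_deg (fun d => (d < n)%N || pred1 n d)).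
  apply: has_dim_disjoint => //; last exact: has_dim_hilbert.
    by move=> d /= lt_dn; rewrite ltn_eqF.
  exact: has_dim_cumul.
by congr in_deg; apply/funext => d /=; rewrite ltnS leq_eqVlt orbC.
Qed.

Lemma cumul_adj_colon J f e n : is_ideal J -> graded J -> f \is e.-homog ->
  cumul J (n + e) = (cumul (ideal_adj J f) (n + e) + cumul (colon J f) n)%N.
Proof.
move=> Ji Jg fe; apply: quotient_dimE; first exact: ideal_subspace.
apply: (has_dim_adj_colon Ji Jg fe).
  by apply: has_dim_cumul; apply: ideal_adj_ideal.
rewrite (_ : in_deg _ = in_deg (fun d => d < n)%N).
  by apply: has_dim_cumul; apply: colon_ideal.
by congr in_deg; apply/funext => d; rewrite ltn_add2r.
Qed.

Lemma cumul_sub I J n : is_ideal I -> is_ideal J -> I `<=` J ->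
  (cumul J n <= cumul I n)%N.
Proof.
move=> Ii Ji IJ; have [v [vD vf _]] := has_dim_cumul n Ji.
apply: indep_has_dim vD _ (has_dim_cumul n Ii); first exact: ideal_subspace.
by move=> c /IJ; apply: vf.
Qed.

Lemma cumul_gt0 J n : is_ideal J -> ~ J 1 -> (0 < cumul J n.+1)%N.
Proof.
move=> Ji J1.
apply: (@indep_has_dim _ _ (in_deg (fun d => d < n.+1)%N) J 1 _ (fun _ => 1)) => //.
- exact: ideal_subspace.
- by move=> _ m; rewrite msupp1 inE => /eqP ->; rewrite mdeg0.
- move=> c; rewrite big_ord1 => Jc i; rewrite ord1.
  apply: contrapT => /eqP c0; apply: J1.
  have -> : 1 = (c ord0)^-1 *: (c ord0 *: 1) :> S by rewrite scalerA mulVf ?scale1r.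
  by case: (ideal_subspace Ji) => _ _; apply.
- exact: has_dim_cumul.
Qed.

Lemma cumul_max J n : is_ideal J -> ~ J 1 -> (forall i, J 'X_i) ->
  cumul J n.+1 = 1%N.
Proof.
move=> Ji J1 JX; apply/eqP; rewrite eqn_leq cumul_gt0 // andbT.
have [v [vD vf _]] := has_dim_cumul n.+1 Ji.
have Js := ideal_subspace Ji.
apply: (indep_le_span Js vf (w := fun _ : 'I_1 => 1)) => i.
exists (fun=> (v i)@_0%MM); rewrite big_ord1.
rewrite [X in X - _]mpolyE.
have -> : (v i)@_0%MM *: 1 =
    \sum_(m <- msupp (v i)) (if m == 0%MM then (v i)@_m *: 'X_[m] else 0).
  rewrite -big_mkcond /= -big_filter.
  have [v0|v0] := boolP (0%MM \in msupp (v i)); last first.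
    rewrite (memN_msupp_eq0 v0) scale0r big_filter big1_seq // => m /andP[/eqP -> m0].
    by rewrite m0 in v0.
  by rewrite filter_pred1_uniq ?msupp_uniq // big_seq1 mpolyX0.
rewrite -sumrB; apply: ideal_sum => // m _ _.
case: eqP => [_|/eqP m0]; first by rewrite subrr; apply: ideal0.
rewrite subr0 -mul_mpolyC; apply: ideal_mull => //.
have [j mj] : exists j, m j != 0%N.
  apply: contrapT => nj; move/eqP: m0; apply; apply/mnmP => j; rewrite mnm0E.
  by apply: contrapT => /eqP mj; apply: nj; exists j.
have /submK <- : (U_(j) <= m)%MM by rewrite lep1mP.
by rewrite mpolyXD; apply: ideal_mull.
Qed.

End Graded.

(** * Noetherian induction and associated primes *)

Definition increasing (phi : nat -> nat) : Prop := forall i, (phi i < phi i.+1)%N.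

Lemma increasing_lt phi i j : increasing phi -> (i < j)%N -> (phi i < phi j)%N.
Proof.
move=> inc; elim: j => // j IHj; rewrite ltnS leq_eqVlt => /predU1P[->//|/IHj].
by move/ltn_trans; apply.
Qed.

Lemma nondecreasing_subseq (u : nat -> nat) :
  exists2 phi, increasing phi & forall i j, (i <= j)%N -> (u (phi i) <= u (phi j))%N.
Proof.
have tail_min N : exists i, (N <= i)%N /\ forall j, (N <= j)%N -> (u i <= u j)%N.
  have ex0 : exists v, `[< exists2 i, (N <= i)%N & u i = v >].
    by exists (u N); apply/asboolP; exists N.
  have [_ /asboolP[i le_Ni <-] vmin] := ex_minnP ex0.
  by exists i; split=> // j le_Nj; apply: vmin; apply/asboolP; exists j.
have [g gP] := choice tail_min.
pose phi n := iter n (fun k => g k.+1) (g 0%N).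
have phi_inc : increasing phi by move=> i; have [] := gP (phi i).+1.
have phi_min n j : (phi n <= j)%N -> (u (phi n) <= u j)%N.
  case: n => [|n] le_j; first by have [_] := gP 0%N; apply.
  have [_] := gP (phi n).+1; apply.
  exact: leq_trans (phi_inc n) le_j.
exists phi => // i j; rewrite leq_eqVlt => /predU1P[->//|lt_ij].
by apply/phi_min/ltnW/increasing_lt.
Qed.

(** Dickson's lemma: extract nondecreasing subsequences one coordinate at a time. *)
Lemma dickson s (a : nat -> 'X_{1..s}) :
  exists i j, (i < j)%N /\ (a i <= a j)%MM.
Proof.
have sub k : (k <= s)%N -> exists2 phi, increasing phi &
    forall i j, (i <= j)%N ->
    forall c : 'I_s, (c < k)%N -> (a (phi i) c <= a (phi j) c)%N.
  elim: k => [_|k IHk le_ks]; first by exists id.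
  have [phi inc aP] := IHk (ltnW le_ks).
  have [psi psi_inc uP] := nondecreasing_subseq (fun i => a (phi i) (Ordinal le_ks)).
  exists (phi \o psi) => [i|i j le_ij c]; first exact: increasing_lt inc (psi_inc i).
  rewrite ltnS leq_eqVlt => /predU1P[ck|lt_ck].
    have -> : c = Ordinal le_ks by apply/val_inj.
    exact: uP.
  apply: aP => //; move: le_ij; rewrite leq_eqVlt => /predU1P[->//|lt_ij].
  exact/ltnW/(increasing_lt psi_inc).
have [phi inc aP] := sub s (leqnn s).
exists (phi 0%N), (phi 1%N); split; first exact: inc.
by apply/mnm_lepP => c; apply: aP.
Qed.

Section Noetherian.
Variables (K : fieldType) (s : nat).
Local Notation S := {mpoly K[s]}.
Implicit Types (f g h : S) (I J P Q : set S).

(** Division by the leading terms of [I] turns any element of [J] outside [I]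
    into one with a new leading monomial. *)
Lemma new_lead_monom I J : is_ideal I -> is_ideal J -> I `<` J ->
  exists f, [/\ J f, f != 0 & forall g, I g -> g != 0 -> mlead g <> mlead f].
Proof.
move=> Ii Ji [IJ /existsNP[f0 /not_implyP[Jf0 If0]]].
move: {2}(mlead f0) (erefl (mlead f0)) => m.
elim/(well_founded_induction (@ltom_wf s)): m f0 Jf0 If0 => m IHm f Jf If fm.
have f0 : f != 0 by apply: contra_notN If => /eqP ->; apply: ideal0.
have [new|] := pselect (forall g, I g -> g != 0 -> mlead g <> mlead f).
  by exists f.
move=> /existsNP[g /not_implyP[Ig /not_implyP[g0 /contrapT gf]]].
have gc0 : mleadc g != 0 by rewrite mleadc_eq0.
pose c := mleadc f / mleadc g; pose h := f - c *: g.
have Icg : I (c *: g) by rewrite -mul_mpolyC; apply: ideal_mull.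
have Ih : ~ I h by move=> Ih; apply: If; rewrite -(subrK (c *: g) f); apply: idealD.
have h0 : h != 0 by apply: contra_notN Ih => /eqP ->; apply: ideal0.
apply: (IHm (mlead h) _ h) => //; last by apply: idealB => //; apply: IJ.
have hf : h@_(mlead f) = 0.
  by rewrite mcoeffB mcoeffZ /c -gf divfK // subrr.
rewrite -fm lt_neqAle; apply/andP; split.
  by apply: contraNneq h0 => eq_h; rewrite -mleadc_eq0 eq_h hf.
apply: le_trans (mleadB_le _ _) _; rewrite leUx lexx /= -gf.
exact: mleadZ_le.
Qed.

(** Hilbert's basis theorem. In a strictly increasing sequence of ideals each step
    gains a leading monomial, which by Dickson's lemma is eventually a multiple of
    an earlier one, hence not new. *)
Theorem ideal_noeth_ind (Pr : set S -> Prop) :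
  (forall J, is_ideal J -> (forall J', is_ideal J' -> J `<` J' -> Pr J') -> Pr J) ->
  forall J, is_ideal J -> Pr J.
Proof.
move=> IH J Ji; apply: contrapT => nPJ.
pose bad := {J : set S | is_ideal J /\ ~ Pr J}.
have step (B : bad) : exists B' : bad, sval B `<` sval B'.
  case: B => I [Ii nPI] /=; apply: contrapT => nB; apply: nPI; apply: IH => // J' J'i IJ'.
  by apply: contrapT => nPJ'; apply: nB; exists (exist _ J' (conj J'i nPJ')).
have [next nextP] := choice step.
pose A n := iter n next (exist _ J (conj Ji nPJ) : bad).
have Ai n : is_ideal (sval (A n)) by case: (svalP (A n)).
have Amono m n : (m <= n)%N -> sval (A m) `<=` sval (A n).
  move=> /subnK <-; elim: (n - m)%N => // k IHk f /IHk.
  by case: (nextP (A (k + m)%N)) => sub _; apply: sub.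
have [a aP] := choice (fun n => new_lead_monom (Ai n) (Ai n.+1) (nextP (A n))).
have [i [j [lt_ij le_a]]] := dickson (fun n => mlead (a n)).
have [Aai ai0 _] := aP i; have [_ _] := aP j.
move/(_ ('X_[mlead (a j) - mlead (a i)] * a i)); apply.
- by apply: ideal_mull (Ai j) _; apply: Amono lt_ij _ Aai.
- rewrite mulf_neq0 // -msupp_eq0 msuppX //.
- by rewrite mleadM ?mleadXm ?submK // -msupp_eq0 msuppX.
Qed.

Lemma ideal_maximal (F : set (set S)) I :
  (forall J, F J -> is_ideal J) -> F I ->
  exists2 J, F J & forall J', F J' -> J `<=` J' -> J' `<=` J.
Proof.
move=> Fi FI; have Ii := Fi I FI; move: I Ii FI.
apply: ideal_noeth_ind => J Ji IHJ FJ.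
have [Jmax|] := pselect (forall J', F J' -> J `<=` J' -> J' `<=` J).
  by exists J.
move=> /existsNP[J' /not_implyP[FJ' /not_implyP[JJ' nJ'J]]].
by apply: (IHJ J') => //; apply: Fi.
Qed.

(** An ideal maximal among the [I : h'], where [h'] is a form outside [I], is prime:
    if [f] is a form outside [I : h'], then [I : f h'] is not larger than [I : h']. *)
Lemma graded_assoc_prime I h e : is_ideal I -> graded I -> h \is e.-homog -> ~ I h ->
  exists P, [/\ associated_prime I P, graded P & colon I h `<=` P].
Proof.
move=> Ii Ig he Ih.
pose F := [set J | exists h', [/\ h' \is homog mdeg, ~ I h', J = colon I h'
                                & colon I h `<=` J]].
have [||_ [h' [/homogP[e' he'] Ih' -> sub]] Pmax] := @ideal_maximal F (colon I h).
- by move=> _ [h' [_ _ -> _]]; apply: colon_ideal.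
- by exists h; split=> //; apply/homogP; exists e.
have Pi := colon_ideal h' Ii; have Pg := graded_colon Ii Ig he'.
exists (colon I h'); split=> //; split; last by exists h'.
apply: homog_prime_prime => //; first by rewrite /colon /= mul1r.
move=> d1 d2 f g fd gd Pfg; have [Pf|Pf] := pselect (colon I h' f); [by left|right].
have sub' : colon I h' `<=` colon I (f * h').
  by rewrite -colon_colon; apply: sub_colon.
apply: (Pmax (colon I (f * h'))) => //; last by rewrite /colon /= mulrA (mulrC g).
exists (f * h'); split=> //; last exact: subset_trans sub sub'.
by apply/homogP; exists (d1 + e')%N; apply: dhomogM.
Qed.

(** An ideal [I : h] maximal among those contained in [P] is prime: if it contains [a b]
    but not [b], then [I : a h] is not contained in [P], so [u a h] is in [I] for some
    [u] outside [P], and [I : u h] is contained in [P] and contains [a]. *)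
Lemma assoc_prime_below I P : is_ideal I -> is_prime P -> I `<=` P ->
  exists2 Q, associated_prime I Q & Q `<=` P.
Proof.
move=> Ii Pp IP; have Pi := prime_ideal Pp.
pose F := [set J | exists2 h, J = colon I h & J `<=` P].
have [||_ [h -> hP] Qmax] := @ideal_maximal F (colon I 1).
- by move=> _ [h -> _]; apply: colon_ideal.
- by exists 1 => // f; rewrite /colon /= mulr1 => /IP.
have Qi := colon_ideal h Ii.
exists (colon I h) => //; split; last by exists h.
split=> //; first by move=> QT; apply: (prime_proper Pp); apply: hP; rewrite QT.
move=> a b Qab; apply: contrapT => /not_orP[Qa Qb].
have [u Pu Iu] : exists2 u, ~ P u & I (u * (a * h)).
  apply: contrapT => nu; apply: Qb.
  apply: (Qmax (colon I (a * h))).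
  - exists (a * h) => // u Iu; apply: contrapT => Pu; apply: nu; by exists u.
  - by rewrite -colon_colon; apply: sub_colon.
  - by rewrite /colon /= mulrA (mulrC b).
apply: Qa; apply: (Qmax (colon I (u * h))).
- exists (u * h) => // v Iv.
  have /(primeM Pp)[] // : P (v * u) by apply: hP; rewrite /colon /= -mulrA.
- by rewrite -colon_colon; apply: sub_colon.
- by rewrite /colon /= mulrCA.
Qed.

End Noetherian.

(** * Dimension as the degree of growth of the Hilbert function *)

Lemma supremum_max (A : set nat) n :
  A n -> (forall m, A m -> (m <= n)%N) -> supremum 0%N A = n.
Proof.
move=> An Amax; have supn : supremums A n.
  by split=> [m /Amax|m]; rewrite ?leEnat //; apply.
rewrite /supremum ifF; last by apply/negbTE/set0P; exists n.
by apply: xget_subset1 supn _; apply: is_subset1_supremums.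
Qed.

Lemma prime_chain_tail (R : comNzRingType) (P : nat -> set R) n :
  prime_chain P n.+1 -> prime_chain (fun i => P i.+1) n.
Proof. by move=> [Pp Plt]; split=> i le_i; [apply: Pp|apply: Plt]. Qed.

Lemma prime_chain_cons (R : comNzRingType) (P : nat -> set R) (Q : set R) n :
  is_prime Q -> Q `<` P 0%N -> prime_chain P n ->
  prime_chain (fun i => if i is j.+1 then P j else Q) n.+1.
Proof. by move=> Qp QP [Pp Plt]; split=> -[|i] //= le_i; [apply: Pp|apply: Plt]. Qed.

Section Dimension.
Variables (K : fieldType) (s : nat).
Local Notation S := {mpoly K[s]}.
Implicit Types (f g h : S) (I J P Q : set S).

Lemma cumul_leq J m n : is_ideal J -> (m <= n)%N -> (cumul J m <= cumul J n)%N.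
Proof.
move=> Ji le_mn; have [v [vD vf _]] := has_dim_cumul m Ji.
apply: indep_has_dim (ideal_subspace Ji) _ vf (has_dim_cumul n Ji) => i d /vD lt_d.
exact: leq_trans lt_d le_mn.
Qed.

Lemma cumul_le_exp J n : is_ideal J -> (cumul J n <= n.+1 ^ s)%N.
Proof.
move=> Ji; have [v [vD vf _]] := has_dim_cumul n Ji.
have [w wP] := in_deg_spanned (fun d (lt_dn : (d < n)%N) => lt_dn) Ji.
apply: leq_trans (indep_le_span (ideal_subspace Ji) vf (fun i => wP _ (vD i))) _.
have -> : (n.+1 ^ s = #|{: {ffun 'I_s -> 'I_n.+1}}|)%N by rewrite card_ffun !card_ord.
rewrite cardsT.
pose F (m : 'X_{1..s < n}) : {ffun 'I_s -> 'I_n.+1} := [ffun i => inord (m i)].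
apply: (@leq_card _ _ F) => m1 m2 /ffunP eqF; apply/val_inj/mnmP => i.
have lt_mi (m : 'X_{1..s < n}) : (m i < n.+1)%N.
  rewrite ltnS (leq_trans _ (ltnW (bmdeg m))) // mdegE (bigD1 i) //=.
  exact: leq_addr.
by have := eqF i; rewrite !ffunE => /(congr1 val); rewrite /= !inordK.
Qed.

(** Multiplication by [f], which is regular on [S/P], embeds a shifted copy of [S/P]
    into the kernel of the projection of [S/P] onto [S/Q]. *)
Lemma cumul_prime_step P Q f n e : is_prime P -> is_ideal Q -> P `<=` Q ->
  Q f -> ~ P f -> (msize f <= e.+1)%N ->
  (cumul P n + cumul Q (n + e) <= cumul P (n + e))%N.
Proof.
move=> Pp Qi PQ Qf Pf fe; have Pi := prime_ideal Pp.
have [v [vD vf _]] := has_dim_cumul n Pi.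
have [w [wD wf _]] := has_dim_cumul (n + e) Qi.
have sumf (c : 'I_(cumul P n) -> K) :
    \sum_i c i *: (f * v i) = f * \sum_i c i *: v i.
  by rewrite mulr_sumr; apply: eq_bigr => i _; rewrite scalerAr.
rewrite addnC; apply: (@indep_has_dim _ _ (in_deg (fun d => d < n + e)%N) P _ _
  (cat_fam w (fun i => f * v i))); last exact: has_dim_cumul.
- exact: ideal_subspace.
- move=> i; rewrite /cat_fam; case: fintype.split => j; first exact: wD.
  move=> m /msuppM_le /allpairsP[[m1 m2] /= [fm1 /vD vm2 ->]].
  by rewrite mdegD; have := leq_trans (msize_mdeg_lt fm1) fe; lia.
- move=> c; rewrite sum_cat_fam sumf => Pc.
  have cl : forall i, c (lshift _ i) = 0.
    apply: wf; apply: (ideal_addKr Qi _ (PQ _ Pc)).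
    exact: (ideal_mulr _ Qi Qf).
  have cr : forall i, c (rshift _ i) = 0.
    apply: vf; move: Pc; under eq_bigr do rewrite cl scale0r.
    by rewrite big1 // add0r => /(primeM Pp)[].
  by move=> i; rewrite -(fintype.splitK i); case: (fintype.split i) => j /=.
Qed.

(** Each inclusion of the chain raises the degree of growth by one, as Pascal's rule
    shows when [cumul_prime_step] is iterated. *)
Lemma prime_chain_cumul (P : nat -> set S) n : prime_chain P n ->
  exists E, forall m, ('C(m + n, n) <= cumul (P 0%N) (E * m).+1)%N.
Proof.
elim: n P => [|n IHn] P Pch.
  have [/(_ 0%N isT) P0 _] := Pch.
  exists 0%N => m; rewrite bin0; apply: cumul_gt0 (prime_ideal P0) (prime_proper P0).
have [E EP] := IHn _ (prime_chain_tail Pch).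
have [Pp /(_ 0%N isT) [P01 /existsNP[f /not_implyP[P1f P0f]]]] := Pch.
have P0p : is_prime (P 0%N) by apply: Pp.
have P1i : is_ideal (P 1%N) by apply/prime_ideal/Pp.
pose E' := (E + msize f)%N; exists E'; elim=> [|m IHm].
  by rewrite add0n binn muln0; apply: cumul_gt0 (prime_ideal P0p) (prime_proper P0p).
have fE' : (msize f <= E'.+1)%N by rewrite /E'; lia.
have := cumul_prime_step (E' * m).+1 P0p P1i P01 P1f P0f fE'.
rewrite addSn -mulnSr; apply: leq_trans.
rewrite addSn addnS binS; apply: leq_add; first by rewrite -addnS.
rewrite -addSn; apply: leq_trans (EP m.+1) _.
by apply: cumul_leq => //; rewrite ltnS leq_mul // /E' leq_addr.
Qed.

Lemma prime_chain_le J (P : nat -> set S) n k C : is_ideal J ->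
  (forall i, (cumul J i <= C * i.+1 ^ k)%N) ->
  prime_chain P n -> J `<=` P 0%N -> (n <= k)%N.
Proof.
move=> Ji JC Pch JP; have [E EP] := prime_chain_cumul Pch.
have P0i : is_ideal (P 0%N) by case: Pch => /(_ 0%N isT) /prime_ideal.
apply: (@exp_growth_le n k (n`! * (C * (E + 2) ^ k))) => m.
apply: leq_trans (exp_le_binom m n) _; rewrite -mulnA leq_mul2l; apply/orP; right.
apply: leq_trans (EP m) _; apply: leq_trans (cumul_sub _ Ji P0i JP) _.
apply: leq_trans (JC _) _; rewrite -mulnA leq_mul2l -expnMn; apply/orP; right.
by apply: leq_expl; nia.
Qed.

Lemma prime_chain_le_nvars (P : nat -> set S) n : prime_chain P n -> (n <= s)%N.
Proof.
move=> Pch; have P0i : is_ideal (P 0%N) by case: Pch => /(_ 0%N isT) /prime_ideal.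
by apply: (@prime_chain_le (P 0%N) _ _ _ 1) (Pch) _ => // i; rewrite mul1n cumul_le_exp.
Qed.

Lemma le_krull_dim J (P : nat -> set S) n :
  prime_chain P n -> J `<=` P 0%N -> (n <= krull_dim J)%N.
Proof.
move=> Pch JP; rewrite -leEnat; apply: ge_supremum_Nmem; last by exists P.
by apply: nat_supremums_neq0; exists s => m [Q [/prime_chain_le_nvars Qch _]].
Qed.

Lemma krull_dim_growth_eq J (P : nat -> set S) k e : is_ideal J ->
  poly_growth k e (fun n => (cumul J n)%:Z) -> prime_chain P k -> J `<=` P 0%N ->
  krull_dim J = k.
Proof.
move=> Ji /poly_growth_bound[C JC] Pch JP; apply: supremum_max; first by exists P.
move=> n [Q [Qch JQ]]; apply: (prime_chain_le (C := C) Ji) Qch JQ => i.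
by have := JC i; rewrite ger0_norm // lez_nat.
Qed.

Lemma adj_proper J f g : is_ideal J -> J (f * g) -> ~ J g -> ~ ideal_adj J f 1.
Proof.
move=> Ji Jfg Jg; rewrite ideal_adjE // => -[i Ji' [a e1]]; apply: Jg.
rewrite -[g]mul1r e1 mulrDl -mulrA.
by apply: idealD => //; [apply: ideal_mulr|apply: ideal_mull].
Qed.

Lemma graded_adj_proper J f e : is_ideal J -> graded J -> ~ J 1 ->
  f \is e.-homog -> (0 < e)%N -> ~ ideal_adj J f 1.
Proof.
move=> Ji Jg J1 fe e_gt0; rewrite ideal_adjE // => -[i Ji' [a e1]]; apply: J1.
have in1 : in_deg (pred1 0%N) (1 : S).
  by move=> m; rewrite msupp1 inE => /eqP ->; rewrite /= mdeg0.
rewrite -(deg_part_id in1) e1 linearD /= (deg_partM _ _ fe).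
rewrite (_ : deg_part (fun d => _) a = 0) ?mul0r ?addr0; first exact: graded_deg_part.
apply/mpolyP => m; rewrite mcoeff_deg_part mcoeff0 /=.
by rewrite addn_eq0 (gtn_eqF e_gt0) andbF.
Qed.

(** The Hilbert-Serre theorem for graded ideals, by Noetherian induction. When two
    forms [f] and [g] outside [J] have their product in [J], the exact sequence of
    [f] expresses [J] by the larger ideals [(J, f)] and [J : f]. When [J] is prime and a
    variable [t_i] is outside [J], one has [J : t_i = J], so that the Hilbert
    function of [(J, t_i)] is the difference of that of [J], and [J] is put in front of
    a chain of primes above [(J, t_i)]. *)
Theorem hilbert_growth J : is_ideal J -> graded J -> ~ J 1 ->
  exists (k : nat) (e : int) (P : nat -> set S), [/\ 1 <= e,
    poly_growth k e (fun n => (cumul J n)%:Z), prime_chain P k,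
    J `<=` P 0%N & graded (P 0%N)].
Proof.
move: J; apply: ideal_noeth_ind => J Ji IHJ Jg J1.
have [Jhp|] := pselect (homog_prime J).
  have Jp := homog_prime_prime Ji Jg J1 Jhp.
  have [JX|/existsNP[i JXi]] := pselect (forall i, J 'X_i).
    exists 0%N, 1, (fun=> J); split=> //.
    by exists 1%N => -[//|n] _ /=; rewrite cumul_max.
  have Xi : ('X_i : S) \is 1.-homog by rewrite dhomogX /= mdeg1.
  have adjP : J `<` ideal_adj J 'X_i.
    by split=> [|/(_ _ (@ideal_adj_mem _ J 'X_i))//]; apply: sub_ideal_adj.
  have adji := ideal_adj_ideal J 'X_i.
  have [k [e [P [e_gt0 kP Pch adjP0 P0g]]]] :=
    IHJ _ adji adjP (graded_adj Ji Jg Xi) (graded_adj_proper Ji Jg J1 Xi isT).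
  exists k.+1, e, (fun i => if i is j.+1 then P j else J); split=> //.
    apply/poly_growthS.
    rewrite (_ : fdiff _ = fun n => (cumul (ideal_adj J 'X_i) (n + 1))%:Z).
      exact/(poly_growth_shift 1 _ _ (fun n => (cumul (ideal_adj J 'X_i) n)%:Z)).
    apply/funext => n; rewrite /fdiff -addn1 (cumul_adj_colon _ Ji Jg Xi).
    by rewrite (colon_prime Jp JXi) PoszD addrK.
  apply: prime_chain_cons => //; split=> [|P0J]; first exact: subset_trans adjP.1 adjP0.
  by apply: JXi; apply: P0J; apply: adjP0; apply: ideal_adj_mem.
move=> /existsNP[d /existsNP[d' /existsNP[f /existsNP[g]]]].
move=> /not_implyP[fd /not_implyP[gd' /not_implyP[Jfg /not_orP[Jf Jg']]]].
have [k1 [e1 [P1 [e1_gt0 k1P P1ch adjP1 P1g]]]] :=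
  IHJ _ (ideal_adj_ideal J f) (conj (@sub_ideal_adj _ J f)
    (fun sub => Jf (sub _ (@ideal_adj_mem _ J f)))) (graded_adj Ji Jg fd)
    (adj_proper Ji Jfg Jg').
have Jgf : colon J f g by rewrite /colon /= mulrC.
have colon1 : ~ colon J f 1 by rewrite /colon /= mul1r.
have [k2 [e2 [P2 [e2_gt0 k2P P2ch colonP2 P2g]]]] :=
  IHJ _ (colon_ideal f Ji) (conj (@sub_colon _ J f Ji) (fun sub => Jg' (sub _ Jgf)))
    (graded_colon Ji Jg fd) colon1.
have JE : (fun n => (cumul J (n + d))%:Z) = fun n =>
    (cumul (ideal_adj J f) (n + d))%:Z + (cumul (colon J f) n)%:Z.
  by apply/funext => n; rewrite (cumul_adj_colon _ Ji Jg fd) PoszD.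
have JP1 : J `<=` P1 0%N by apply: subset_trans adjP1; apply: sub_ideal_adj.
have JP2 : J `<=` P2 0%N by apply: subset_trans colonP2; apply: sub_colon.
have shJ k e := poly_growth_shift d k e (fun n => (cumul J n)%:Z).
move/(poly_growth_shift d k1 e1 (fun n => (cumul (ideal_adj J f) n)%:Z)) : k1P => k1P.
have [lt_k|lt_k|eq_k] := ltngtP k1 k2.
- exists k2, e2, P2; split=> //; apply/shJ; rewrite JE -(add0r e2).
  by apply: poly_growthD => //; apply: poly_growth_lt lt_k k1P.
- exists k1, e1, P1; split=> //; apply/shJ; rewrite JE -(addr0 e1).
  by apply: poly_growthD => //; apply: poly_growth_lt lt_k k2P.
- exists k1, (e1 + e2), P1; split=> //; first lia.
  by apply/shJ; rewrite JE; apply: poly_growthD => //; rewrite eq_k.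
Qed.

Lemma krull_dim_growth J : is_ideal J -> graded J -> ~ J 1 ->
  exists2 e, 1 <= e & poly_growth (krull_dim J) e (fun n => (cumul J n)%:Z).
Proof.
move=> Ji Jg J1; have [k [e [P [e_gt0 kP Pch JP _]]]] := hilbert_growth Ji Jg J1.
by exists e => //; rewrite (krull_dim_growth_eq Ji kP Pch JP).
Qed.

Lemma krull_dim_chain J : is_ideal J -> graded J -> ~ J 1 ->
  exists P : nat -> set S,
    [/\ prime_chain P (krull_dim J), J `<=` P 0%N & graded (P 0%N)].
Proof.
move=> Ji Jg J1; have [k [e [P [e_gt0 kP Pch JP P0g]]]] := hilbert_growth Ji Jg J1.
by exists P; rewrite (krull_dim_growth_eq Ji kP Pch JP).
Qed.

Lemma krull_dim_sub I J : is_ideal J -> graded J -> ~ J 1 -> I `<=` J ->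
  (krull_dim J <= krull_dim I)%N.
Proof.
move=> Ji Jg J1 IJ; have [P [Pch JP _]] := krull_dim_chain Ji Jg J1.
exact: le_krull_dim Pch (subset_trans IJ JP).
Qed.

End Dimension.

(** * The height of a graded prime *)

Lemma prime_chain_rcons (R : comNzRingType) (P : nat -> set R) (Q : set R) n :
  prime_chain P n -> is_prime Q -> P n `<` Q ->
  prime_chain (fun i => if (i <= n)%N then P i else Q) n.+1.
Proof.
move=> [Pp Plt] Qp PQ; split=> i le_i; first by case: leqP => // /Pp.
rewrite ltnS in le_i; rewrite le_i; have [lt_in|le_ni] := ltnP i n; first exact: Plt.
by have -> : i = n by apply/eqP; rewrite eqn_leq le_i.
Qed.

Lemma prime_chain_cat (R : comNzRingType) (P Q : nat -> set R) m n :
  prime_chain P m -> prime_chain Q n -> P m `<=` Q 0%N ->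
  prime_chain (fun i => if (i < m)%N then P i else Q (i - m)%N) (m + n).
Proof.
move=> [Pp Plt] [Qp Qlt] PQ; split=> i le_i.
  case: ltnP => [/ltnW/Pp//|le_mi]; apply: Qp; lia.
case: (ltnP i.+1 m) => [lt_i|le_mi].
  by rewrite (ltnW lt_i); apply: Plt; apply: ltnW.
case: ltnP => [lt_im|le_mi'].
  have -> : (i.+1 - m = 0)%N by lia.
  have mi : m = i.+1 by lia.
  have [sub nsub] := Plt i lt_im; rewrite -mi in sub nsub.
  by split=> [|QP]; [apply: subset_trans PQ|apply: nsub; apply: subset_trans QP].
by rewrite subSn //; apply: Qlt; lia.
Qed.

Section Height.
Variables (K : fieldType) (s : nat).
Local Notation S := {mpoly K[s]}.
Implicit Types (f g h : S) (I J P Q : set S) (m : 'X_{1..s}) (i j : 'I_s)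
  (U W : {set 'I_s}).

Definition mnm_drop j m : 'X_{1..s} := [multinom if i == j then 0%N else m i | i < s].

Definition var_coef j n f : S :=
  \sum_(m <- msupp f | m j == n) f@_m *: 'X_[mnm_drop j m].

(** The substitution [t_j |-> X], which views [S] as [K[t_i, i <> j][X]]. *)
Definition isolate j : S -> {poly S} :=
  mmap (polyC \o @mpolyC s K) (fun i => if i == j then 'X else ('X_i)%:P).

HB.instance Definition _ j := GRing.RMorphism.on (isolate j).

Lemma isolateX j m : isolate j 'X_[m] = ('X_[mnm_drop j m])%:P * 'X^(m j).
Proof.
rewrite /isolate mmapX /mmap1 mpolyXE_id [LHS](bigD1 j) //=
  [in RHS](bigD1 j) //= eqxx mnmE eqxx expr0 mul1r.
rewrite mulrC rmorph_prod /=; congr (_ * _); apply: eq_bigr => i /negPf ij.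
by rewrite ij mnmE ij rmorphXn.
Qed.

Lemma isolate_exists j : exists phi : {rmorphism S -> {poly S}},
  (forall f n, (phi f)`_n = var_coef j n f) /\ (forall f, (phi f).['X_j] = f).
Proof.
exists (isolate j); split=> [f n|f].
  rewrite [f in LHS]mpolyE rmorph_sum /= coef_sum /var_coef.
  rewrite [RHS]big_mkcond /=; apply: eq_bigr => m _.
  rewrite -!mul_mpolyC rmorphM /= isolateX [isolate j _%:MP]mmapC /=.
  rewrite !coefCM coefXn eq_sym; case: eqP => _; last by rewrite !mulr0.
  by rewrite mulr1.
rewrite [f in LHS]mpolyE rmorph_sum /= horner_sum [RHS]mpolyE.
apply: eq_bigr => m _; rewrite -!mul_mpolyC rmorphM /= isolateX.
rewrite [isolate j _%:MP]mmapC /= !hornerM !hornerC hornerXn; congr (_ * _).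
rewrite mpolyXn -mpolyXD; congr 'X_[_]; apply/mnmP => i.
rewrite mnmDE mulmnE mnmE mnm1E eq_sym.
by case: eqP => [->|_]; rewrite ?mul1n ?mul0n ?addn0.
Qed.

(** The pullback by [isolate j] of the ideal of [S[X]] generated by [P], which is the
    ideal generated by the elements of [P] in which [t_j] does not occur. *)
Definition var_contract j P : set S := [set f | forall n, P (var_coef j n f)].

Lemma var_contract_prime j P : is_prime P -> is_prime (var_contract j P).
Proof.
move=> Pp; have [phi [phiE _]] := isolate_exists j.
have -> : var_contract j P = phi @^-1` [set p : {poly S} | forall n, P p`_n].
  by apply/seteqP; split=> f /= Pf n; [rewrite phiE|rewrite -phiE].
exact/preimage_prime/poly_prime.
Qed.

Lemma var_contract_sub j P : is_ideal P -> var_contract j P `<=` P.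
Proof.
move=> Pi f Pf; have [phi [phiE phiK]] := isolate_exists j.
rewrite -(phiK f) horner_coef; apply: ideal_sum => // i _ _.
by apply: ideal_mulr => //; rewrite phiE.
Qed.

Lemma var_coef_eq0 j f : (forall n, var_coef j n f = 0) -> f = 0.
Proof.
move=> f0; have [phi [phiE phiK]] := isolate_exists j.
rewrite -(phiK f) (_ : phi f = 0) ?horner0 //.
by apply/polyP => n; rewrite phiE f0 coef0.
Qed.

Definition supp_in W f : Prop :=
  forall m, m \in msupp f -> forall i, i \notin W -> m i = 0%N.

Lemma var_coef_supp W j n f : supp_in (j |: W) f -> supp_in W (var_coef j n f).
Proof.
move=> fW m /msupp_sum_le /flattenP[_ /mapP[m' +] ->].
rewrite mem_filter => /andP[_ fm'] /msuppZ_le /mem_msuppXP <- i iW.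
rewrite mnmE; case: eqP => // /eqP ij; apply: fW => //.
by rewrite !inE negb_or ij.
Qed.

Lemma var_contract_supp W j f P : is_ideal P -> supp_in W f -> j \notin W -> P f ->
  var_contract j P f.
Proof.
move=> Pi fW jW Pf n.
have drop m : m \in msupp f -> (m j = 0%N) /\ mnm_drop j m = m.
  move=> /fW m0; split; first exact: m0.
  by apply/mnmP => i; rewrite mnmE; case: eqP => // ->; rewrite m0.
have [->|n0] := eqVneq n 0%N.
  rewrite (_ : var_coef _ _ _ = f) // /var_coef [RHS]mpolyE big_mkcond /=.
  by apply: eq_big_seq => m /drop[-> ->].
rewrite (_ : var_coef _ _ _ = 0); first exact: ideal0.
by rewrite /var_coef big1_seq // => m /andP[/eqP mj /drop[m0 _]]; rewrite -mj m0 in n0.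
Qed.

Definition alg_indep P U : Prop := forall f, supp_in U f -> P f -> f = 0.

(** Contracting successively the variables of [l] gives a strictly descending chain
    of primes: the algebraic relation of [w] over [U] is lost when [w] is
    contracted, and not before. *)
Lemma contraction_chain U (l : seq 'I_s) Q : is_prime Q -> alg_indep Q U -> uniq l ->
  (forall w, w \in l -> w \notin U) ->
  (forall w, w \in l -> exists f, [/\ f <> 0, Q f & supp_in (w |: U) f]) ->
  exists R, prime_chain R (size l) /\ R (size l) = Q.
Proof.
elim: l Q => [|w l IHl] Q Qp QU /= l_uniq lU rel.
  by exists (fun=> Q).
have [wl ul] := andP l_uniq; have Qi := prime_ideal Qp.
have wU : w \notin U by apply: lU; rewrite mem_head.
have [||||R [Rch RQ]] := IHl (var_contract w Q) _ _ ul.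
- exact: var_contract_prime.
- by move=> f fU /(var_contract_sub Qi); apply: QU.
- by move=> w' w'l; apply: lU; rewrite inE w'l orbT.
- move=> w' w'l; have [|f [f0 Qf fU]] := rel w'; first by rewrite inE w'l orbT.
  exists f; split=> //; apply: var_contract_supp Qi fU _ Qf.
  by rewrite !inE negb_or wU andbT; apply: contraNneq wl => ->.
have [f [f0 Qf fU]] := rel w (mem_head _ _).
exists (fun k : nat => if (k <= size l)%N then R k else Q); split; last by rewrite ltnn.
apply: prime_chain_rcons => //; rewrite RQ; split; first exact: var_contract_sub.
move=> /(_ _ Qf) Qf'; apply: f0; apply: (@var_coef_eq0 w) => n.
by apply: QU (Qf' n); apply: var_coef_supp.
Qed.

Lemma alg_indep0 P : is_prime P -> alg_indep P finset.set0.
Proof.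
move=> Pp f f0 Pf; have m0 m : m \in msupp f -> m = 0%MM.
  by move=> /f0 mE; apply/mnmP => i; rewrite mnm0E mE // inE.
have fE : f = (f@_0%MM)%:MP.
  apply/mpolyP => m; rewrite mcoeffC; case: eqP => [->|/eqP mN0]; first by rewrite mulr1.
  by rewrite mulr0; apply: memN_msupp_eq0; apply: contra mN0 => /m0 ->.
have [c0|c0] := eqVneq f@_0%MM 0; first by rewrite fE c0 mpolyC0.
case: (prime_proper Pp).
rewrite (_ : 1 = (f@_0%MM)^-1%:MP * f); first exact: ideal_mull (prime_ideal Pp) Pf.
by rewrite {2}fE -mpolyCM mulVf // mpolyC1.
Qed.

(** The bound counts the monomials in the variables of [U] with exponents at most [n],
    which are linearly independent modulo [P] and have degree at most [s n]. *)
Lemma alg_indep_cumul P U n : is_ideal P -> alg_indep P U ->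
  (n.+1 ^ #|U| <= cumul P (s * n).+1)%N.
Proof.
move=> Pi PU.
pose A := pffun_on (ord0 : 'I_n.+1) (mem U) (mem 'I_n.+1).
pose mon (phi : {ffun 'I_s -> 'I_n.+1}) : 'X_{1..s} := [multinom val (phi i) | i < s].
have mon_inj : injective mon.
  by move=> p q /mnmP pq; apply/ffunP => i; have := pq i; rewrite !mnmE => /val_inj.
have cardA : #|A| = (n.+1 ^ #|U|)%N by rewrite card_pffun_on card_ord.
rewrite -cardA; pose v (i : 'I_#|A|) : S := 'X_[mon (enum_val i)].
apply: (@indep_has_dim _ _ (in_deg (fun d => d < (s * n).+1)%N) P _ _ v).
- exact: ideal_subspace.
- move=> i m; rewrite /v msuppX inE => /eqP ->; rewrite mdegE ltnS.
  apply: (@leq_trans (\sum_(i < s) n)); last by rewrite sum_nat_const card_ord.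
  by apply: leq_sum => j _; rewrite mnmE -ltnS ltn_ord.
- move=> c Pc i.
  have /PU/(_ Pc) c0 : supp_in U (\sum_i c i *: v i).
    move=> m /msupp_sum_le /flattenP[_ /mapP[j _ ->]].
    move=> /msuppZ_le /mem_msuppXP <- k kU; rewrite mnmE.
    have /pffun_onP[/supportP sup _] := enum_valP j.
    by rewrite sup.
  have := congr1 (mcoeff (mon (enum_val i))) c0.
  rewrite mcoeff0 raddf_sum /= (bigD1 i) //= mcoeffZ mcoeffX eqxx mulr1.
  rewrite big1 ?addr0 // => j ji; rewrite mcoeffZ mcoeffX.
  case: eqP => [/mon_inj/enum_val_inj eq_ji|_]; last by rewrite mulr0.
  by rewrite eq_ji eqxx in ji.
- exact: has_dim_cumul.
Qed.

Lemma alg_indep_le_dim P U : is_prime P -> graded P -> alg_indep P U ->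
  (#|U| <= krull_dim P)%N.
Proof.
move=> Pp Pg PU; have Pi := prime_ideal Pp.
have [e _ /poly_growth_bound[C PC]] := krull_dim_growth Pi Pg (prime_proper Pp).
apply: (@exp_growth_le _ _ (C * (s + 2) ^ krull_dim P)) => n.
apply: leq_trans (alg_indep_cumul n Pi PU) _.
apply: (@leq_trans (C * (s * n).+2 ^ krull_dim P)).
  by have := PC (s * n).+1; rewrite ger0_norm // lez_nat.
rewrite -mulnA leq_mul2l -expnMn; apply/orP; right.
by apply: leq_expl; nia.
Qed.

(** A maximal set [U] of variables algebraically independent modulo [P] gives a chain
    of length [s - |U|] ending in [P], and [|U|] is at most the dimension of [S/P];
    on the other hand no chain of primes of [S] is longer than [s]. *)
Lemma height_graded_prime P : is_prime P -> graded P ->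
  (krull_dim P <= s)%N /\ height P = (s - krull_dim P)%N.
Proof.
move=> Pp Pg; have Pi := prime_ideal Pp.
have [Q [Qch PQ _]] := krull_dim_chain Pi Pg (prime_proper Pp).
have bound n R : prime_chain R n -> R n = P -> (n + krull_dim P <= s)%N.
  move=> Rch RP; have := prime_chain_cat Rch Qch; rewrite RP => /(_ PQ).
  exact: prime_chain_le_nvars.
have dim_le : (krull_dim P <= s)%N by apply: prime_chain_le_nvars Qch.
split=> //; apply: supremum_max; last first.
  by move=> n [R [Rch RP]]; have := bound _ _ Rch RP; lia.
have ind0 : `[< alg_indep P finset.set0 >] by apply/asboolP/alg_indep0.
have [U /asboolP PU Umax] := arg_maxnP (P := fun U => `[< alg_indep P U >])
  (fun U : {set 'I_s} => #|U|) ind0.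
have rel w : w \in enum (~: U) -> exists f, [/\ f <> 0, P f & supp_in (w |: U) f].
  rewrite mem_enum inE => wU; apply: contrapT => nrel.
  suff /asboolP/Umax : alg_indep P (w |: U) by rewrite /= cardsU1 wU add1n ltnn.
  move=> f fU Pf; apply: contrapT => f0; apply: nrel; by exists f.
have [|R [Rch RP]] := contraction_chain Pp PU (enum_uniq (~: U)) _ rel.
  by move=> w; rewrite mem_enum inE.
have := bound _ _ Rch RP; have := alg_indep_le_dim Pp Pg PU.
have sizeU : size (enum (~: U)) = (s - #|U|)%N.
  by rewrite -cardE cardsCs finset.setCK card_ord.
rewrite sizeU => le_U le_s; have -> : (s - krull_dim P = s - #|U|)%N.
  have := max_card U; rewrite card_ord; lia.
by exists R; rewrite -sizeU.
Qed.

End Height.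

(** * Dimension and degree of unmixed graded ideals *)

Section Unmixed.
Variables (K : fieldType) (s : nat).
Local Notation S := {mpoly K[s]}.
Implicit Types (f g h : S) (I J P Q : set S).

(** The bottom of a chain of primes of maximal length above [I] is minimal over [I],
    hence associated to [I]; so the common height of the associated primes is
    [s - dim (S/I)]. *)
Lemma associated_prime_dim I P : is_ideal I -> graded I -> ~ I 1 -> unmixed I ->
  associated_prime I P -> graded P -> krull_dim P = krull_dim I.
Proof.
move=> Ii Ig I1 Iu Pass Pg; have [R [Rch IR R0g]] := krull_dim_chain Ii Ig I1.
have R0p : is_prime (R 0%N) by case: Rch => /(_ 0%N isT).
have [Q Qass QR] := assoc_prime_below Ii R0p IR.
have [Qp [q Qq]] := Qass.
have IQ : I `<=` Q by rewrite Qq; apply: sub_colon.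
have QE : Q = R 0%N.
  apply/seteqP; split=> //; apply: contrapT => nRQ.
  have := le_krull_dim (prime_chain_cons Qp (conj QR nRQ) Rch) IQ.
  by rewrite ltnn.
have dimR : krull_dim (R 0%N) = krull_dim I.
  apply/eqP; rewrite eqn_leq (le_krull_dim Rch) // andbT.
  exact: krull_dim_sub (prime_ideal R0p) R0g (prime_proper R0p) IR.
have [Pp _] := Pass.
have [leP hP] := height_graded_prime Pp Pg.
have [leR hR] := height_graded_prime R0p R0g.
have := Iu _ _ Pass Qass; rewrite QE hP hR -dimR; lia.
Qed.

(** [I : f] lies between [I] and one of its associated primes. *)
Lemma krull_dim_colon I f d : is_ideal I -> graded I -> unmixed I ->
  f \is d.-homog -> ~ I f -> krull_dim (colon I f) = krull_dim I.
Proof.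
move=> Ii Ig Iu fd If; have I1 : ~ I 1.
  by move=> I1; apply: If; rewrite -[f]mulr1; apply: ideal_mull.
have [P [Pass Pg fP]] := graded_assoc_prime Ii Ig fd If.
have [Pp _] := Pass.
have f1 : ~ colon I f 1 by rewrite /colon /= mul1r.
apply/eqP; rewrite eqn_leq.
rewrite (krull_dim_sub (colon_ideal f Ii) (graded_colon Ii Ig fd) f1);
  last exact: sub_colon.
rewrite -(associated_prime_dim Ii Ig I1 Iu Pass Pg) /=.
exact: krull_dim_sub (prime_ideal Pp) Pg (prime_proper Pp) fP.
Qed.

(** A zero divisor [f] modulo [I] lies in an associated prime [P] of [I], and
    [(I, f)] is between [I] and [P]. *)
Lemma krull_dim_adj I f d : is_ideal I -> graded I -> unmixed I ->
  zero_div_forms I d f -> ~ ideal_adj I f 1 /\ krull_dim (ideal_adj I f) = krull_dim I.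
Proof.
move=> Ii Ig Iu [fd If nz]; have I1 : ~ I 1.
  by move=> I1; apply: If; rewrite -[f]mulr1; apply: ideal_mull.
have [h0 Ih0f Ih0] : exists2 h, colon I f h & ~ I h.
  apply: contrapT => nh; apply: nz; apply/seteqP; split; last exact: sub_colon.
  by move=> h hf; apply: contrapT => Ih; apply: nh; exists h.
have [e Ih he] := graded_homog_notin Ii Ih0.
set h := pihomog mdeg e h0 in Ih he.
have Ihf : colon I f h by apply: graded_colon Ii Ig fd _ _ _.
have [P [Pass Pg hP]] := graded_assoc_prime Ii Ig he Ih.
have [Pp [p Pcol]] := Pass; have Pi := prime_ideal Pp.
have adjP : ideal_adj I f `<=` P.
  apply: ideal_adj_sub => //; first by rewrite Pcol; apply: sub_colon.
  by apply: hP; rewrite /colon /= mulrC.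
have adj1 : ~ ideal_adj I f 1 by move=> /adjP; apply: prime_proper.
have adji := ideal_adj_ideal I f; have adjg := graded_adj Ii Ig fd.
split=> //; apply/eqP; rewrite eqn_leq (krull_dim_sub adji adjg adj1) //=.
  rewrite -(associated_prime_dim Ii Ig I1 Iu Pass Pg).
  exact: krull_dim_sub Pi Pg (prime_proper Pp) adjP.
exact: sub_ideal_adj.
Qed.

(** Where the cumulative function is constant, the Hilbert function vanishes: all forms
    of degree at least [n0] are in [J]. *)
Lemma quotient_dimT J n0 n : is_ideal J -> graded J ->
  (forall i, (n0 <= i)%N -> cumul J i = n) -> quotient_dim setT J = n.
Proof.
move=> Ji Jg Jn; apply: quotient_dimE; first exact: ideal_subspace.
rewrite -(Jn n0) //; have [v [vD vf vs]] := has_dim_cumul n0 Ji.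
exists v; split=> // a _.
have [c Jc] := vs _ (@in_deg_part _ _ (fun d => d < n0)%N a).
exists c; rewrite -[a](subrK (deg_part (fun d => d < n0)%N a)) -addrA.
apply: idealD => //.
have -> : a - deg_part (fun d => d < n0)%N a = deg_part (fun d => n0 <= d)%N a.
  apply/mpolyP => m; rewrite mcoeffB !mcoeff_deg_part.
  by case: leqP => _; rewrite ?subr0 ?subrr.
rewrite deg_part_pihomog; apply: ideal_sum => // i _ le_i.
have [w [_ _ ws]] : has_dim (in_deg (pred1 (i : nat))) J 0.
  have := cumulS i Ji Jg; rewrite !Jn //; last exact: leqW.
  by move/eqP; rewrite -[X in X == _]addn0 eqn_add2l => /eqP ->; apply: has_dim_hilbert.
have [|b] := ws (pihomog mdeg i a); last by rewrite big_ord0 subr0.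
by rewrite -deg_part1; apply: in_deg_part.
Qed.

(** The degree is the constant [e] of the growth of the cumulative Hilbert function;
    in positive dimension the Hilbert function is its difference. *)
Lemma deg_growth J e : is_ideal J -> graded J -> 1 <= e ->
  poly_growth (krull_dim J) e (fun n => (cumul J n)%:Z) -> (deg J)%:Z = e.
Proof.
move=> Ji Jg; case: e => // e e_gt0; rewrite /deg; case: (krull_dim J) => [|k].
  move=> [n0 Jn]; congr Posz; apply: (@quotient_dimT _ n0) => // n /Jn /= [].
  by [].
move=> /poly_growthS.
rewrite (_ : fdiff _ = fun n => (hilbert J n)%:Z); last first.
  by apply/funext => n; rewrite /fdiff cumulS // PoszD; ring.
move=> /poly_growth_cvg Jcvg; congr Posz.
apply: xget_subset1; first exact: Jcvg.
move=> a b /= ae be; apply/eqP; rewrite -(eqr_nat rat); apply/eqP.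
exact: (cvg_unique _ ae be).
Qed.

Lemma deg_gt0 J : is_ideal J -> graded J -> ~ J 1 -> (0 < deg J)%N.
Proof.
move=> Ji Jg J1; have [e e_gt0 kP] := krull_dim_growth Ji Jg J1.
by have := deg_growth Ji Jg e_gt0 kP; lia.
Qed.

Lemma deg_leq I J : is_ideal I -> graded I -> is_ideal J -> graded J -> ~ J 1 ->
  I `<=` J -> krull_dim J = krull_dim I -> (deg J <= deg I)%N.
Proof.
move=> Ii Ig Ji Jg J1 IJ dimJ; have I1 : ~ I 1 by move/IJ.
have [e e_gt0 Ie] := krull_dim_growth Ii Ig I1.
have [e' e'_gt0 Je] := krull_dim_growth Ji Jg J1.
rewrite -lez_nat (deg_growth Ii Ig e_gt0 Ie) (deg_growth Ji Jg e'_gt0 Je).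
rewrite dimJ in Je; apply: poly_growth_le Je Ie => n.
by rewrite lez_nat cumul_sub.
Qed.

(** The exact sequence of [f]; its three terms have the same dimension, so that the
    leading coefficients of their Hilbert functions add up. *)
Lemma deg_adj_colon I f d : is_ideal I -> graded I -> unmixed I ->
  zero_div_forms I d f -> deg I = (deg (ideal_adj I f) + deg (colon I f))%N.
Proof.
move=> Ii Ig Iu fz; have [fd If _] := fz.
have [adj1 dim_adj] := krull_dim_adj Ii Ig Iu fz.
have dim_col := krull_dim_colon Ii Ig Iu fd If.
have col1 : ~ colon I f 1 by rewrite /colon /= mul1r.
have I1 : ~ I 1 by move=> I1; apply: If; rewrite -[f]mulr1; apply: ideal_mull.
have adji := ideal_adj_ideal I f; have adjg := graded_adj Ii Ig fd.
have coli := colon_ideal f Ii; have colg := graded_colon Ii Ig fd.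
have [e e_gt0 Ie] := krull_dim_growth Ii Ig I1.
have [e1 e1_gt0 adje] := krull_dim_growth adji adjg adj1.
have [e2 e2_gt0 cole] := krull_dim_growth coli colg col1.
have := deg_growth coli colg e2_gt0 cole.
have := deg_growth adji adjg e1_gt0 adje.
have := deg_growth Ii Ig e_gt0 Ie.
rewrite dim_adj in adje; rewrite dim_col in cole.
move/(poly_growth_shift d (krull_dim I) e1
  (fun n => (cumul (ideal_adj I f) n)%:Z)): adje => adje.
move/(poly_growth_shift d (krull_dim I) e (fun n => (cumul I n)%:Z)): Ie => Ie.
have := poly_growthD adje cole.
rewrite (_ : (fun n => _ + _) = fun n => (cumul I (n + d))%:Z); last first.
  by apply/funext => n; rewrite (cumul_adj_colon n Ii Ig fd) PoszD.
move=> /(poly_growth_uniq Ie); lia.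
Qed.

(** * The minimum distance function *)

Lemma setmaxP (A : set nat) N : A !=set0 -> (forall n, A n -> (n <= N)%N) ->
  A (setmax A) /\ forall n, A n -> (n <= setmax A)%N.
Proof.
move=> [a Aa] AN.
have ex0 : exists n, `[< A n >] by exists a; apply/asboolP.
have bnd n : `[< A n >] -> (n <= N)%N by move/asboolP/AN.
have [m /asboolP Am mmax] := ex_maxnP ex0 bnd.
rewrite /setmax; case: xgetP => [n _ [] //|/(_ m)[]].
by split=> // n An; apply/mmax/asboolP.
Qed.

(** By additivity of the degree, the distance is the least degree of an ideal
    [I : f]. *)
Lemma min_distP I d : is_ideal I -> graded I -> unmixed I ->
  zero_div_forms I d !=set0 ->
  (exists2 f, zero_div_forms I d f & min_dist I d = (deg (colon I f))%:Z) /\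
  forall f, zero_div_forms I d f -> min_dist I d <= (deg (colon I f))%:Z.
Proof.
move=> Ii Ig Iu F0; have /negPf Fn : zero_div_forms I d != set0 by apply/set0P.
rewrite /min_dist Fn; set A := [set _ | _ in _].
have AN n : A n -> (n <= deg I)%N.
  by move=> [f fz <-]; rewrite (deg_adj_colon Ii Ig Iu fz) leq_addr.
have A0 : A !=set0 by have [f fz] := F0; exists (deg (ideal_adj I f)); exists f.
have [[f fz fE] Amax] := setmaxP A0 AN; split.
  exists f => //; rewrite -fE (deg_adj_colon Ii Ig Iu fz); lia.
move=> g gz; have := Amax _ (ex_intro2 _ _ g gz erefl).
rewrite (deg_adj_colon Ii Ig Iu gz); lia.
Qed.

Theorem min_dist_ge1 I d : is_ideal I -> graded I -> ~ I 1 -> unmixed I ->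
  1 <= min_dist I d.
Proof.
move=> Ii Ig I1 Iu; have [F0|/set0P/(min_distP Ii Ig Iu)[[f [fd If _] ->] _]] :=
  eqVneq (zero_div_forms I d) set0.
  by rewrite /min_dist F0 eqxx; have := deg_gt0 Ii Ig I1; lia.
have : (0 < deg (colon I f))%N; last by lia.
apply: deg_gt0; [exact: colon_ideal|exact: graded_colon fd|].
by rewrite /colon /= mul1r.
Qed.

(** Multiplying the form that realizes the distance in degree [d] by a variable
    enlarges its colon ideal, whose degree can then only drop. Some variable
    keeps the form outside [I]: otherwise its colon ideal contains all
    variables and has dimension zero. *)
Theorem min_dist_nonincreasing I d : is_ideal I -> graded I -> unmixed I ->
  (0 < krull_dim I)%N -> zero_div_forms I d !=set0 ->
  min_dist I d.+1 <= min_dist I d.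
Proof.
move=> Ii Ig Iu dimI F0; have [[f fz ->] _] := min_distP Ii Ig Iu F0.
have [fd If nz] := fz; have col1 : ~ colon I f 1 by rewrite /colon /= mul1r.
have coli := colon_ideal f Ii; have colg := graded_colon Ii Ig fd.
have dimf := krull_dim_colon Ii Ig Iu fd If.
have [i Xif] : exists i, ~ I ('X_i * f).
  apply: contrapT => nX; move: dimI; rewrite -dimf ltnNge; move/negP; apply.
  have [P [Pch fP _]] := krull_dim_chain coli colg col1.
  have colX i : colon I f 'X_i by apply: contrapT => Xi; apply: nX; exists i.
  apply: (prime_chain_le (C := 1) coli) Pch fP => n; rewrite expn0 muln1.
  by rewrite (leq_trans (cumul_leq coli (leqnSn n))) // cumul_max.
have Xfd : 'X_i * f \is d.+1.-homog.
  by rewrite -add1n; apply: dhomogM => //; rewrite dhomogX /= mdeg1.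
have subX : colon I f `<=` colon I ('X_i * f).
  by rewrite -colon_colon; apply: sub_colon.
have Xfz : zero_div_forms I d.+1 ('X_i * f).
  split=> // colE; apply: nz; apply/seteqP; split; last exact: sub_colon.
  by apply: subset_trans subX _; rewrite colE.
have [_ /(_ _ Xfz)] := min_distP Ii Ig Iu (ex_intro _ _ Xfz).
move=> /le_trans; apply; rewrite lez_nat.
apply: (deg_leq coli colg (colon_ideal _ Ii) (graded_colon Ii Ig Xfd) _ subX).
  by rewrite /colon /= mul1r.
by rewrite dimf; apply: krull_dim_colon Xfd _.
Qed.

End Unmixed.

(** * Initial ideals *)

Lemma seq_least (T : eqType) (r : rel T) (l : seq T) : transitive r -> total r ->
  l != [::] -> exists2 x, x \in l & forall y, y \in l -> r x y.
Proof.
move=> r_tr r_tot; elim: l => // a l IHl _.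
have [->|/IHl[x xl xmin]] := eqVneq l [::].
  by exists a => [|y]; rewrite ?inE // => /eqP ->; have := r_tot a a; rewrite orbb.
have [rax|rxa] := orP (r_tot a x).
  exists a; first exact: mem_head.
  move=> y /predU1P[->|/xmin]; first by have := r_tot a a; rewrite orbb.
  exact: r_tr.
by exists x; [rewrite inE xl orbT|move=> y /predU1P[->|/xmin]].
Qed.

Section InitialIdeal.
Variables (K : fieldType) (s : nat) (mle : rel 'X_{1..s}).
Hypothesis mle_mo : monomial_order mle.
Local Notation S := {mpoly K[s]}.
Implicit Types (f g h : S) (I J P Q : set S) (m : 'X_{1..s}).

Definition lead_monoms I : set 'X_{1..s} :=
  [set m | exists2 f, I f & is_lead_monom mle f m].

Lemma lead_monom_exists f : f != 0 -> exists m, is_lead_monom mle f m.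
Proof.
rewrite -msupp_eq0; case: mle_mo => _ mle_tr mle_tot _ _ f0.
have [m mf mmax] := seq_least (r := fun x y => mle y x)
  (fun y x z xy yz => mle_tr _ _ _ yz xy) (fun x y => mle_tot y x) f0.
by exists m.
Qed.

Lemma lead_monoms_up I m m' : is_ideal I -> lead_monoms I m ->
  lead_monoms I (m' + m)%MM.
Proof.
case: mle_mo => _ _ _ _ mleD Ii [f If [mf mmax]].
exists (f * 'X_[m']); first exact: ideal_mulr.
have suppE := perm_mem (msuppMX f m').
split; first by rewrite suppE; apply: map_f.
move=> k; rewrite suppE => /mapP[l lf ->].
by rewrite addmC (addmC m'); apply: mleD; apply: mmax.
Qed.

Lemma initial_idealE I : is_ideal I ->
  initial_ideal mle I = [set g | forall m, m \in msupp g -> lead_monoms I m].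
Proof.
move=> Ii; apply/seteqP; split.
  apply: smallest_sub; first split.
  - by move=> m; rewrite msupp0.
  - by move=> f g fI gI m /msuppD_le; rewrite mem_cat => /orP[/fI|/gI].
  - move=> f g gI m /msuppM_le /allpairsP[[m1 m2] /= [_ /gI m2I ->]].
    exact: lead_monoms_up.
  - by move=> _ [f [m [If mf ->]]] m' /mem_msuppXP <-; exists f.
move=> g gI; have inI : is_ideal (initial_ideal mle I) by apply: ideal_gen_ideal.
rewrite [g]mpolyE; apply: (ideal_sum inI) => m /gI[f If mf] _.
rewrite -mul_mpolyC; apply: (ideal_mull _ inI).
by apply: sub_gen_smallest; exists f, m.
Qed.

Lemma initial_ideal_ideal I : is_ideal (initial_ideal mle I).
Proof. exact: ideal_gen_ideal. Qed.

Lemma graded_initial_ideal I : is_ideal I -> graded (initial_ideal mle I).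
Proof.
move=> Ii; apply: gradedP; first exact: initial_ideal_ideal.
rewrite initial_idealE // => f D fI m; rewrite mcoeff_msupp mcoeff_deg_part.
by case: ifP => _; rewrite ?eqxx // -mcoeff_msupp; apply: fI.
Qed.

(** A criterion for a set of monomials to be a basis, phrased so that it applies both
    to an ideal and to its initial ideal: the spanned subspace is an arbitrary [A]. *)
Lemma has_dim_monoms J n (B : {set 'X_{1..s < n}}) : is_ideal J ->
  (forall f, (forall m, m \in msupp f -> exists2 b, b \in B & m = b) -> J f -> f = 0) ->
  (forall A : set S, is_subspace A -> J `<=` A -> (forall b, b \in B -> A 'X_[b]) ->
    forall m : 'X_{1..s < n}, A 'X_[m]) ->
  has_dim (in_deg (fun d => d < n)%N) J #|B|.
Proof.
move=> Ji indep span; have Js := ideal_subspace Ji.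
pose v (i : 'I_#|B|) : S := 'X_[enum_val i : 'X_{1..s < n}].
exists v; split.
- by move=> i m; rewrite /v msuppX inE => /eqP ->; apply: bmdeg.
- move=> c Jc i.
  have /indep/(_ Jc) c0 m : m \in msupp (\sum_i c i *: v i) -> exists2 b, b \in B & m = b.
    move=> /msupp_sum_le /flattenP[_ /mapP[j _ ->]].
    move=> /msuppZ_le /mem_msuppXP <-.
    by exists (enum_val j); first exact: enum_valP.
  have := congr1 (mcoeff (enum_val i : 'X_{1..s < n})) c0.
  rewrite mcoeff0 raddf_sum /= (bigD1 i) //= mcoeffZ mcoeffX eqxx mulr1.
  rewrite big1 ?addr0 // => j ji; rewrite mcoeffZ mcoeffX.
  case: eqP => [/val_inj/enum_val_inj eq_ji|_]; last by rewrite mulr0.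
  by rewrite eq_ji eqxx in ji.
- move=> a an.
  have sum0 : \sum_i (0 : K) *: v i = 0 by rewrite big1 // => i _; rewrite scale0r.
  have As : is_subspace (span_mod J v).
    split.
    + by exists (fun=> 0); rewrite sum0 subrr; case: Js.
    + move=> x y [c Jc] [d Jd]; exists (fun i => c i + d i).
      under eq_bigr do rewrite scalerDl.
      by rewrite big_split opprD addrACA; case: Js => _ JD _; apply: JD.
    + move=> k x [c Jc]; exists (fun i => k * c i).
      under eq_bigr do rewrite -scalerA.
      by rewrite -scaler_sumr -scalerBr; case: Js => _ _; apply.
  have JA : J `<=` span_mod J v.
    by move=> x Jx; exists (fun=> 0); rewrite sum0 subr0.
  have BA b : b \in B -> span_mod J v 'X_[b].
    move=> bB; exists (fun i => (i == enum_rank_in bB b)%:R).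
    rewrite (bigD1 (enum_rank_in bB b)) //= eqxx scale1r big1 ?addr0.
      by rewrite /v enum_rankK_in // subrr; apply: ideal0.
    by move=> i /negPf ->; rewrite scale0r.
  have an' : (msize a <= n)%N by rewrite msizeE; apply/bigmax_leqP_seq => m /an.
  rewrite -/(span_mod J v a).
  rewrite [a](mpolywE an'); apply: (subspace_sum _ As) => m _.
  by case: (As) => _ _; apply; apply: span.
Qed.

(** Macaulay's theorem: the monomials outside the initial ideal form a basis both
    modulo [I] and modulo its initial ideal. *)
Theorem cumul_initial_ideal I n : is_ideal I -> graded I ->
  cumul (initial_ideal mle I) n = cumul I n.
Proof.
move=> Ii Ig; have inI := initial_ideal_ideal I.
pose B : {set 'X_{1..s < n}} := [set m : 'X_{1..s < n} | `[< ~ lead_monoms I m >]]%SET.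
have BP (m : 'X_{1..s < n}) : m \in B <-> ~ lead_monoms I m.
  by rewrite inE; split=> /asboolP.
transitivity #|B|.
  apply: quotient_dimE; first exact: ideal_subspace.
  apply: has_dim_monoms => //.
    move=> f fB fI; apply/eqP/negP => /negP/lead_monom_exists[m [mf _]].
    move: fI; rewrite initial_idealE // => /(_ m mf).
    by have [b /BP bB ->] := fB m mf.
  move=> A _ JA BA m; have [mI|/BP/BA //] := pselect (lead_monoms I m).
  by apply: JA; rewrite initial_idealE // => m' /mem_msuppXP <-.
symmetry; apply: quotient_dimE; first exact: ideal_subspace.
apply: has_dim_monoms => //.
  move=> f fB If; apply/eqP/negP => /negP/lead_monom_exists[m mf].
  by have [b /BP bB mb] := fB m mf.1; apply: bB; rewrite -mb; exists f.
move=> A As IA BA m; apply: contrapT => mA.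
(* The least monomial outside A is the leading one of an element of I whose other
   monomials lie in A. *)
case: mle_mo => mle_anti mle_tr mle_tot _ _.
pose bad : seq 'X_{1..s < n} :=
  [seq k : 'X_{1..s < n} <- enum predT | `[< ~ A 'X_[k] >]].
have bad0 : bad != [::].
  by rewrite -has_filter; apply/hasP; exists m; [rewrite mem_enum|apply/asboolP].
have [k] := seq_least (r := fun x y : 'X_{1..s < n} => mle x y)
  (fun y x z => @mle_tr y x z) (fun x y => mle_tot x y) bad0.
rewrite mem_filter => /andP[/asboolP kA _] kmin.
have [[f If [kf kmax]]|/BP/BA //] := pselect (lead_monoms I k).
pose g := deg_part (pred1 (mdeg k)) f.
have gk : g@_k != 0 by rewrite mcoeff_deg_part /= eqxx -mcoeff_msupp.
have gE : g = \sum_(m' <- msupp g) g@_m' *: 'X_[m'] by rewrite -mpolyE.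
rewrite (bigD1_seq (k : 'X_{1..s})) ?msupp_uniq ?mcoeff_msupp //= in gE.
apply: kA; case: (As) => _ _ AZ.
rewrite -['X_[k]]scale1r -(mulVf gk) -scalerA; apply: (AZ).
rewrite (_ : g@_k *: _ = g - \sum_(m' <- msupp g | m' != k) g@_m' *: 'X_[m']); last first.
  by apply/eqP; rewrite eq_sym subr_eq -gE.
apply: subspaceB => //; first by apply: IA; apply: graded_deg_part.
rewrite big_seq_cond; apply: (subspace_sum _ As) => m' /andP[m'g m'k]; apply: (AZ).
have m'deg : mdeg m' = mdeg k by apply/eqP/(in_deg_part m'g).
have m'n : (mdeg m' < n)%N by rewrite m'deg bmdeg.
apply: contrapT => nA; case/eqP: m'k; apply: mle_anti.
rewrite kmax; last first.
  by move: m'g; rewrite !mcoeff_msupp mcoeff_deg_part /= m'deg eqxx.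
by apply: (kmin (BMultinom m'n)); rewrite mem_filter mem_enum andbT; apply/asboolP.
Qed.

Lemma initial_ideal_proper I : is_ideal I -> graded I -> ~ I 1 -> ~ initial_ideal mle I 1.
Proof.
move=> Ii Ig I1 in1; have := cumul_gt0 0 Ii I1; have inI := initial_ideal_ideal I.
rewrite -(cumul_initial_ideal 1 Ii Ig).
have [v [_ vf _]] := has_dim_cumul 1 inI; case: (cumul _ _) v vf => // c v vf _.
suff /eqP : 1 = 0 :> K by rewrite oner_eq0.
apply: (vf (fun=> 1) _ ord0); rewrite -[X in initial_ideal _ _ X]mulr1.
exact: (ideal_mull _ inI in1).
Qed.

Lemma deg_initial_ideal I : is_ideal I -> graded I -> ~ I 1 ->
  deg (initial_ideal mle I) = deg I.
Proof.
move=> Ii Ig I1; have in1 := initial_ideal_proper Ii Ig I1.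
have inI := initial_ideal_ideal I; have ing := graded_initial_ideal Ii.
have [e e_gt0 Ie] := krull_dim_growth Ii Ig I1.
have [e' e'_gt0 ine] := krull_dim_growth inI ing in1.
have cumulE : (fun n => (cumul (initial_ideal mle I) n)%:Z) = fun n => (cumul I n)%:Z.
  by apply/funext => n; rewrite cumul_initial_ideal.
have := deg_growth inI ing e'_gt0 ine; have := deg_growth Ii Ig e_gt0 Ie.
rewrite cumulE in ine; have eq_dim := poly_growth_deg_uniq e'_gt0 e_gt0 ine Ie.
rewrite eq_dim in ine; have := poly_growth_uniq ine Ie; lia.
Qed.

(** The degree of [I] is that of its initial ideal, so the footprint is positive for the
    same reason as the minimum distance of the initial ideal, the forms being
    restricted to monomials. *)
Theorem footprint_ge1 I d : is_ideal I -> graded I -> ~ I 1 ->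
  unmixed (initial_ideal mle I) -> 1 <= footprint mle I d.
Proof.
move=> Ii Ig I1 inu; have in1 := initial_ideal_proper Ii Ig I1.
have inI := initial_ideal_ideal I; have ing := graded_initial_ideal Ii.
rewrite /footprint -deg_initial_ideal //; case: ifPn => [_|/set0P M0].
  by have := deg_gt0 inI ing in1; lia.
have zm m : zero_div_monoms mle I d m -> zero_div_forms (initial_ideal mle I) d 'X_[m].
  by move=> [md mI mz]; split=> //; rewrite dhomogX; apply/eqP.
set A := [set _ | _ in _].
have AN n : A n -> (n < deg (initial_ideal mle I))%N.
  move=> [m /zm mz <-]; rewrite (deg_adj_colon inI ing inu mz) -addn1 leq_add2l.
  case: mz => mh mI _; apply: deg_gt0; [exact: colon_ideal|exact: graded_colon mh|].
  by rewrite /colon /= mul1r.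
have A0 : A !=set0.
  have [m mz] := M0.
  by exists (deg (ideal_adj (initial_ideal mle I) 'X_[m])); exists m.
have [/AN] := setmaxP A0 (fun n An => ltnW (AN n An)); lia.
Qed.

End InitialIdeal.

Theorem theorem3p6 (K : fieldType) (s : nat) (I : set {mpoly K[s]})
  (I_ideal : is_ideal I) (I_graded : graded I)
  (I_neq0 : I <> [set 0]) (I_proper : I <> setT) (I_unmixed : unmixed I)
  (mle : rel 'X_{1..s}) (mle_mo : monomial_order mle)
  (d : nat) (d_gt0 : (0 < d)%N) :
  [/\ 1 <= min_dist I d,
      unmixed (initial_ideal mle I) -> 1 <= footprint mle I d
    & (1 <= krull_dim I)%N ->
      (forall e, (0 < e)%N -> zero_div_forms I e !=set0) ->
      forall e, (0 < e)%N ->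
        min_dist I e.+1 <= min_dist I e /\ 1 <= min_dist I e.+1].
Proof.
have I1 : ~ I 1 by apply/(ideal_proper I_ideal).
split=> [||dimI Fe e e_gt0].
- exact: min_dist_ge1.
- exact: footprint_ge1.
- split; last exact: min_dist_ge1.
  by apply: min_dist_nonincreasing => //; apply: Fe.
Qed.
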